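(* Let $A$ be a Dedekind domain of characteristic zero such that for each height one prime ideal $\mathfrak{p}$ of $A$ the local ring $A_{\mathfrak{p}}$ has mixed characteristic with finite residue field. Let $R=A[X_1,\ldots,X_n]$ with its standard $\mathbb{Z}^n$-multigrading, let $I=(a_1U_1,\ldots,a_cU_c)\subseteq R$ be a $\mathfrak{C}$-monomial ideal, where the $a_j$ are nonzero elements of $A$ and the $U_j$ are monomials in $X_1,\ldots,X_n$, fix $i\ge 0$, and let $M=H^i_I(R)=\bigoplus_{\underline{u}\in\mathbb{Z}^n}M_{\underline{u}}$. Fix $\underline{u}\in\mathbb{Z}^n$. Then the Bass numbers $\mu_j(\mathfrak{q},M_{\underline{u}})$ of the $A$-module $M_{\underline{u}}$ are finite for each prime ideal $\mathfrak{q}$ in $A$ and every $j\ge 0$.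
   Context: The grading on $R=A[X_1,\ldots,X_n]$ is given by $\deg a=\underline{0}$ for $a\in A$ and $\deg X_j=e_j$, the $j$-th standard basis vector of $\mathbb{N}^n$. A $\mathfrak{C}$-monomial ideal in $R$ is an ideal that can be generated by some elements of the form $aU$, where $a\in A$ (possibly a nonunit) and $U=X_1^{\xi_1}\cdots X_n^{\xi_n}$ is a monomial with some $\xi_j\neq 0$. $H^i_I(R)$ denotes the $i$-th local cohomology module of $R$ supported on $I$, with its induced natural $\mathbb{Z}^n$-grading; $M_{\underline{u}}$ is its graded component of degree $\underline{u}$, an $A$-module. The Bass number is $\mu_j(\mathfrak{q},L)=\dim_{k(\mathfrak{q})}\operatorname{Ext}^j_{A_{\mathfrak{q}}}(k(\mathfrak{q}),L_{\mathfrak{q}})$ with $k(\mathfrak{q})=A_{\mathfrak{q}}/\mathfrak{q}A_{\mathfrak{q}}$. A local ring has mixed characteristic if it has characteristic $0$ and its residue field has positive characteristic. *)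

(* Defs.v *)
From HB Require Import structures.
From mathcomp Require Import all_boot all_order all_algebra.
From mathcomp Require Import mpoly.

Set Implicit Arguments.
Unset Strict Implicit.
Unset Printing Implicit Defensive.

Import GRing.Theory.
Local Open Scope ring_scope.

(* Not required to be proper, unlike idealr_closed of ring_quotient. *)
Definition is_ideal (S : comNzRingType) (J : {pred S}) : Prop :=
  0 \in J /\ forall a x y, x \in J -> y \in J -> a * x + y \in J.

Definition is_prime (S : comNzRingType) (p : {pred S}) : Prop :=
  [/\ is_ideal p, 1 \notin p & prime_idealr_closed p].

Definition is_zero_ideal (S : comNzRingType) (J : {pred S}) : Prop :=
  forall x, x \in J -> x = 0.

Definition gen_ideal (S : comNzRingType) c (f : 'I_c -> S) (x : S) : Prop :=
  exists g : 'I_c -> S, x = \sum_(j < c) g j * f j.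

Definition noetherian (S : comNzRingType) : Prop :=
  forall J : {pred S}, is_ideal J ->
    exists c (f : 'I_c -> S), forall x, x \in J <-> gen_ideal f x.

Definition integrally_closed (A : idomainType) : Prop :=
  forall x : {fraction A},
    integralOver (@FracField.tofrac A) x -> exists a : A, x = FracField.tofrac a.

Definition dimension_le_one (A : idomainType) : Prop :=
  forall p : {pred A}, is_prime p -> ~ is_zero_ideal p ->
  forall J : {pred A}, is_ideal J -> {subset p <= J} -> 1 \notin J -> J =i p.

(* Fields are allowed. *)
Definition dedekind (A : idomainType) : Prop :=
  [/\ noetherian A, integrally_closed A & dimension_le_one A].

Definition height_one (A : idomainType) (p : {pred A}) : Prop :=
  [/\ is_prime p, ~ is_zero_ideal p &
      forall p' : {pred A}, is_prime p' -> {subset p' <= p} ->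
        is_zero_ideal p' \/ p' =i p].

Definition char_zero (S : nzRingType) : Prop :=
  forall m : nat, (0 < m)%N -> m%:R != 0 :> S.

Definition char_positive (S : nzRingType) : Prop :=
  exists2 m : nat, (0 < m)%N & m%:R = 0 :> S.

(* The rings A_q, k(q) and the modules L_q are specified up to unique
   isomorphism, and statements about them quantify over all such models. *)

Section Localization.
Variables (A : comNzRingType) (q : {pred A}).

Record is_localization (Aq : comNzRingType) (iota : {rmorphism A -> Aq}) :
    Prop := IsLocalization {
  loc_inv : forall s, s \notin q -> exists t, iota s * t = 1;
  loc_frac : forall y, exists a s, s \notin q /\ iota s * y = iota a;
  loc_ker : forall a, iota a = 0 -> exists2 s, s \notin q & s * a = 0 }.

(* pi identifies k with A_q / q A_q. *)
Record is_residue_field (Aq : comNzRingType) (iota : {rmorphism A -> Aq})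
    (k : fieldType) (pi : {rmorphism Aq -> k}) : Prop := IsResidueField {
  res_surj : forall z, exists y, pi y = z;
  res_ker : forall y,
    pi y = 0 <-> exists a t, a \in q /\ y = iota a * t }.

Record is_localized_module (Aq : comNzRingType) (iota : {rmorphism A -> Aq})
    (L : lmodType A) (Lq : lmodType Aq)
    (psi : {linear L -> Lq | iota \; *:%R}) : Prop := IsLocalizedModule {
  locm_frac : forall y, exists x s, s \notin q /\ iota s *: y = psi x;
  locm_ker : forall x, psi x = 0 -> exists2 s, s \notin q & s *: x = 0 }.

Definition mixed_char_finite_residue : Prop :=
  forall (Aq : comNzRingType) (iota : {rmorphism A -> Aq})
         (k : fieldType) (pi : {rmorphism Aq -> k}),
    is_localization iota -> is_residue_field iota pi ->
    [/\ char_zero Aq, char_positive k & exists s : seq k, forall z, z \in s].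

End Localization.

Section Ext.
Variables (S : comNzRingType) (k : fieldType) (pi : {rmorphism S -> k}).

Definition projective (P : lmodType S) : Prop :=
  forall (M N : lmodType S) (g : {linear M -> N}) (f : {linear P -> N}),
    (forall y, exists x, g x = y) ->
    exists h : {linear P -> M}, forall x, g (h x) = f x.

(* k is an S-module through pi. *)
Record is_projective_resolution (P : nat -> lmodType S)
    (d : forall j, {linear P j.+1 -> P j})
    (eps : {linear P 0%N -> k | pi \; *%R}) : Prop := IsProjectiveResolution {
  pr_proj : forall j, projective (P j);
  pr_surj : forall z, exists x, eps x = z;
  pr_exact0 : forall x, eps x = 0 <-> exists y, x = d 0%N y;
  pr_exact : forall j x, d j x = 0 <-> exists y, x = d j.+1 y }.

Variables (P : nat -> lmodType S) (d : forall j, {linear P j.+1 -> P j}).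
Variable (N : lmodType S).

Definition ext_cocycle j (f : {linear P j -> N}) : Prop :=
  forall x, f (d j x) = 0.

Definition ext_coboundary j : (P j -> N) -> Prop :=
  match j with
  | 0 => fun f => forall x, f x = 0
  | j'.+1 => fun f => exists g : {linear P j' -> N}, forall x, f x = g (d j' x)
  end.

(* The classes of the cocycles z_i form a basis over k of H^j(Hom_S(P, N)).   *)
(* The S-action on Ext^j_S(k, N) factors through pi, so an element of k acts  *)
(* as any of its lifts to S, and it vanishes when pi maps the lift to 0.      *)
Definition ext_dim j (r : nat) : Prop :=
  exists z : 'I_r -> {linear P j -> N},
  [/\ forall i, ext_cocycle (z i),
      forall f : {linear P j -> N}, ext_cocycle f ->
        exists c : 'I_r -> S,
          ext_coboundary (fun x => f x - \sum_(i < r) c i *: z i x) &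
      forall c : 'I_r -> S,
        ext_coboundary (fun x => \sum_(i < r) c i *: z i x) ->
        forall i, pi (c i) = 0].

End Ext.

(* mu_j(q, L) = dim_{k(q)} Ext^j_{A_q}(k(q), L_q) is finite. *)
Definition finite_bass_number (A : comNzRingType) (q : {pred A})
    (L : lmodType A) (j : nat) : Prop :=
  forall (Aq : comNzRingType) (iota : {rmorphism A -> Aq})
         (k : fieldType) (pi : {rmorphism Aq -> k})
         (Lq : lmodType Aq) (psi : {linear L -> Lq | iota \; *:%R})
         (P : nat -> lmodType Aq) (d : forall j, {linear P j.+1 -> P j})
         (eps : {linear P 0%N -> k | pi \; *%R}),
    is_localization q iota -> is_residue_field q iota pi ->
    is_localized_module q psi -> is_projective_resolution d eps ->
    exists r : nat, ext_dim pi d Lq j r.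

Definition zdeg (n : nat) := {ffun 'I_n -> int}.

Definition mnm_zdeg n (m : 'X_{1..n}) : zdeg n := [ffun j => (m j)%:Z].

Definition mpoly_comp (A : idomainType) n (u : zdeg n) : {pred {mpoly A[n]}} :=
  [pred p : {mpoly A[n]} | all (fun m => mnm_zdeg m == u) (msupp p)].

Arguments mpoly_comp A {n} u.

Record is_grading (A : idomainType) n (M : lmodType {mpoly A[n]})
    (comp : zdeg n -> {pred M}) : Prop := IsGrading {
  gr_zmod : forall u, zmod_closed (comp u);
  gr_scale : forall u v p x,
    p \in mpoly_comp A u -> x \in comp v -> p *: x \in comp (u + v);
  gr_span : forall x, exists (s : seq (zdeg n)) (y : zdeg n -> M),
    (forall u, y u \in comp u) /\ x = \sum_(u <- s) y u;
  gr_direct : forall (s : seq (zdeg n)) (y : zdeg n -> M),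
    uniq s -> (forall u, y u \in comp u) -> \sum_(u <- s) y u = 0 ->
    forall u, u \in s -> y u = 0 }.

Record gradedModule (A : idomainType) (n : nat) := GradedModule {
  gr_sort :> lmodType {mpoly A[n]};
  gr_comp : zdeg n -> {pred gr_sort};
  gr_axiom : is_grading gr_comp }.

Arguments gr_comp {A n} M u : rename.

Section RingGrading.
Variables (A : idomainType) (n : nat).

Lemma mnm_zdeg_inj : injective (@mnm_zdeg n).
Proof.
move=> m1 m2 /ffunP e; apply/mnmP => j.
by have := e j; rewrite !ffunE => -[].
Qed.

Lemma mpoly_compP (u : zdeg n) (p : {mpoly A[n]}) :
  reflect (forall m, mnm_zdeg m != u -> p@_m = 0) (p \in mpoly_comp A u).
Proof.
rewrite inE; apply: (iffP allP) => [h m mu | h m].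
  apply/eqP; rewrite mcoeff_eq0; apply/negP => /h e.
  by rewrite e in mu.
by rewrite mcoeff_msupp; apply: contraNT => /h ->.
Qed.

Lemma mpoly_grading :
  @is_grading A n {mpoly A[n]}^o (fun u => mpoly_comp A u).
Proof.
split.
- move=> u; split=> [|p q /mpoly_compP hp /mpoly_compP hq].
    by apply/mpoly_compP => m _; rewrite mcoeff0.
  by apply/mpoly_compP => m mu; rewrite mcoeffB hp // hq // subr0.
- move=> u v p x; rewrite !inE => /allP hp /allP hx; apply/allP => m.
  move=> /msuppM_le /allpairsP [[m1 m2] /= [/hp /eqP e1 /hx /eqP e2 ->]].
  apply/eqP/ffunP => j; rewrite -e1 -e2 !ffunE mnmDE.
  by rewrite PoszD.
- move=> p.
  exists [seq mnm_zdeg m | m <- msupp p].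
  exists (fun u => \sum_(m <- msupp p | mnm_zdeg m == u) p@_m *: 'X_[m]).
  split=> [u|].
    apply/mpoly_compP => m mu; rewrite raddf_sum /= big1 // => m' /eqP e.
    rewrite mcoeffZ mcoeffX; case: eqP => [e'|_]; last by rewrite mulr0.
    by rewrite -e' e eqxx in mu.
  rewrite big_map {1}[p]mpolyE; apply: eq_big_seq => m mp.
  rewrite (eq_bigl (pred1 m)); last by move=> m'; rewrite (inj_eq mnm_zdeg_inj).
  by rewrite -big_filter filter_pred1_uniq // big_seq1.
- move=> s y us hy e u su; apply/mpolyP => m; rewrite mcoeff0.
  have [mu|/negPf mu] := eqVneq (mnm_zdeg m) u; last first.
    by move/mpoly_compP: (hy u) => -> //; rewrite mu.
  move/(congr1 (mcoeff m)): e; rewrite mcoeff0 raddf_sum /= (bigD1_seq u) //=.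
  rewrite big1 ?addr0 // => v vu; move/mpoly_compP: (hy v) => -> //.
  by rewrite mu eq_sym.
Qed.

Definition mpoly_graded : gradedModule A n := GradedModule mpoly_grading.

End RingGrading.

(* The component M_u with its structure of A-module, obtained by restriction  *)
(* of scalars along A -> A[X_1, ..., X_n].                                    *)
Section Component.
Variables (A : idomainType) (n : nat) (M : gradedModule A n).

Definition restr_scalars : Type := M.
HB.instance Definition _ := GRing.Zmodule.on restr_scalars.

Definition restr_scale (a : A) (x : restr_scalars) : restr_scalars :=
  a%:MP_[n] *: (x : M).

Fact restr_scaleA a b x :
  restr_scale a (restr_scale b x) = restr_scale (a * b) x.
Proof. by rewrite /restr_scale scalerA -mpolyCM. Qed.
Fact restr_scale1 : left_id 1 restr_scale.
Proof. by move=> x; rewrite /restr_scale mpolyC1 scale1r. Qed.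
Fact restr_scaleDr : right_distributive restr_scale +%R.
Proof. by move=> a x y; rewrite /restr_scale scalerDr. Qed.
Fact restr_scaleDl x : {morph restr_scale^~ x : a b / a + b}.
Proof. by move=> a b; rewrite /restr_scale mpolyCD scalerDl. Qed.

HB.instance Definition _ := GRing.Zmodule_isLmodule.Build A restr_scalars
  restr_scaleA restr_scale1 restr_scaleDr restr_scaleDl.

Variable u : zdeg n.

Definition comp_pred : {pred restr_scalars} := gr_comp M u.

Fact comp_submod_closed : subsemimod_closed comp_pred.
Proof.
have [h0 hB] := gr_zmod (gr_axiom M) u.
have hN x : x \in comp_pred -> - x \in comp_pred.
  by move=> hx; rewrite -sub0r; apply: hB.
split; first split=> // x y hx hy.
  by rewrite -[y]opprK; apply: hB => //; apply: hN.
move=> a x hx; change (a%:MP_[n] *: (x : M) \in gr_comp M u).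
rewrite -[u]add0r; apply: (gr_scale (gr_axiom M)) => //.
apply/mpoly_compP => m m0; rewrite mcoeffC.
case: eqP => [e|_]; last by rewrite mulr0.
by case/eqP: m0; apply/ffunP => j; rewrite e !ffunE mnm0E.
Qed.

HB.instance Definition _ :=
  GRing.isSubmodClosed.Build A restr_scalars comp_pred comp_submod_closed.

Record component := Component {
  comp_val :> restr_scalars;
  comp_valP : comp_val \in comp_pred }.

HB.instance Definition _ := [isSub for comp_val].
HB.instance Definition _ := [Choice of component by <:].
HB.instance Definition _ := [SubChoice_isSubLmodule of component by <:].

End Component.

(* Local cohomology is taken as the right derived functors of the I-torsion
   functor on the category of Z^n-graded modules and homogeneous maps of
   degree 0, which is what provides its natural Z^n-grading. The injective
   objects of this category need not be injective as plain modules. *)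

Section LocalCohomology.
Variables (A : idomainType) (n : nat).
Notation R := {mpoly A[n]}.
Notation grmod := (gradedModule A n).

Definition homogeneous_map (M N : grmod) (f : {linear M -> N}) : Prop :=
  forall u x, x \in gr_comp M u -> f x \in gr_comp N u.

Definition graded_injective (E : grmod) : Prop :=
  forall (M N : grmod) (g : {linear M -> N}) (f : {linear M -> E}),
    homogeneous_map g -> homogeneous_map f -> injective g ->
    exists2 h : {linear N -> E},
      homogeneous_map h & forall x, h (g x) = f x.

Record is_injective_resolution (N : grmod) (E : nat -> grmod)
    (eta : {linear N -> E 0%N}) (delta : forall i, {linear E i -> E i.+1}) :
    Prop := IsInjectiveResolution {
  ir_inj : forall i, graded_injective (E i);
  ir_eta : homogeneous_map eta;
  ir_delta : forall i, homogeneous_map (delta i);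
  ir_mono : injective eta;
  ir_exact0 : forall x, delta 0%N x = 0 <-> exists y, x = eta y;
  ir_exact : forall i x, delta i.+1 x = 0 <-> exists y, x = delta i y }.

Variable I : R -> Prop.

(* x is killed by some power I^t. *)
Definition torsion (M : grmod) (x : M) : Prop :=
  exists t : nat, forall f : 'I_t -> R,
    (forall l, I (f l)) -> (\prod_(l < t) f l) *: x = 0.

Section Cohomology.
Variables (E : nat -> grmod) (delta : forall i, {linear E i -> E i.+1}).

Definition lc_cocycle i (x : E i) : Prop := torsion x /\ delta i x = 0.

Definition lc_coboundary i : E i -> Prop :=
  match i with
  | 0 => fun x => x = 0
  | i'.+1 => fun x => exists2 y : E i', torsion y & x = delta i' y
  end.

End Cohomology.

(* M is isomorphic, as a graded module, to H^i_I(N): the map h induces the    *)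
(* isomorphism from cocycles modulo coboundaries, and is only relevant on     *)
(* cocycles.                                                                  *)
Definition is_local_cohomology (N : grmod) (i : nat) (M : grmod) : Prop :=
  exists (E : nat -> grmod) (eta : {linear N -> E 0%N})
         (delta : forall i, {linear E i -> E i.+1}) (h : E i -> M),
  is_injective_resolution eta delta /\
  [/\ forall p x y, lc_cocycle delta x -> lc_cocycle delta y ->
        h (p *: x + y) = p *: h x + h y,
      forall z, exists2 x, lc_cocycle delta x & h x = z,
      forall x, lc_cocycle delta x -> (h x = 0 <-> lc_coboundary delta x) &
      forall u z, z \in gr_comp M u <->
        exists x, [/\ lc_cocycle delta x, x \in gr_comp (E i) u & h x = z]].

End LocalCohomology.

(* Main.v *)
(* Let q be a prime of A and F = E[q] the elements killed by q in an injective
   resolution E of R. Say that a module has dimension at most r over k(q) if any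
   r + 1 elements satisfy a relation whose coefficients are not all in q; this
   avoids localizing. By induction on the number of generators a_l U_l, the
   degree u part of the cohomology of the I-torsion of F has dimension at most
   2^c, uniformly in u. Adding a generator f = aU changes nothing if a is in q.
   Otherwise f divides the torsion of F up to a factor outside q; if a class
   dies when the condition of f-torsion is dropped, it is a boundary d y, and a
   power of f turns y into a cocycle of another degree, which is why uniformity
   in u is needed. Such divisibility statements replace the Cech complex: they
   follow from injectivity applied to maps defined on monomial ideals of R.

   If t is a uniformizer at q, then division by t in the torsion of E bounds the
   t-torsion of M_u and the quotient M_u / t M_u by the cohomology of F. Finally,
   A_q is a field or a discrete valuation ring, so that Ext^0 and Ext^1 embed in
   these two modules, localized at q, and the higher Ext vanish. *)

Require Import Defs.
From Stdlib Require Import Classical ClassicalEpsilon IndefiniteDescription.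
From HB Require Import structures.
From mathcomp Require Import all_boot all_order all_algebra.
From mathcomp Require Import mpoly.
From mathcomp Require Import ring zify.

Set Implicit Arguments.
Unset Strict Implicit.
Unset Printing Implicit Defensive.

Import GRing.Theory.
Local Open Scope ring_scope.

(** * Classical logic and finite maxima *)

Definition asb (P : Prop) : bool :=
  if excluded_middle_informative P then true else false.

Lemma asbP (P : Prop) : reflect P (asb P).
Proof. by rewrite /asb; case: excluded_middle_informative => h; constructor. Qed.

Lemma all_bounded_nat (I : finType) (P : I -> nat -> Prop) :
  (forall i m m', (m <= m')%N -> P i m -> P i m') ->
  (forall i, exists m, P i m) -> exists m, forall i, P i m.
Proof.
move=> hm hP; have [f hf] := functional_choice _ hP.
by exists (\max_i f i) => i; apply: hm (hf i); apply: leq_bigmax.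
Qed.

(** * Local uniformizers of a Dedekind domain *)

Section Ideals.
Variable S : comNzRingType.
Implicit Types (J : S -> Prop).

Definition idealP J : Prop := J 0 /\ forall a x y, J x -> J y -> J (a * x + y).

Lemma idealP_is_ideal J : idealP J -> is_ideal [pred x | asb (J x)].
Proof.
move=> [h0 h]; split; first by apply/asbP.
by move=> a x y /asbP hx /asbP hy; apply/asbP; apply: h.
Qed.

Lemma gen_ideal_sub J c (f : 'I_c -> S) x :
  idealP J -> (forall l, J (f l)) -> gen_ideal f x -> J x.
Proof.
move=> [h0 h] hf [g ->]; elim/big_ind: _ => // [y z hy hz|l _].
  by rewrite -[y]mul1r; apply: h.
by rewrite -[_ * _]addr0; apply: h.
Qed.

Lemma gen_ideal_gen c (f : 'I_c -> S) l : gen_ideal f (f l).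
Proof.
exists (fun m => (m == l)%:R); rewrite (bigD1 l) //= eqxx mul1r big1 ?addr0 //.
by move=> m /negPf ->; rewrite mul0r.
Qed.

Hypothesis hS : noetherian S.

Lemma noetherian_gen J : idealP J ->
  exists c (f : 'I_c -> S), forall x, J x <-> gen_ideal f x.
Proof.
move=> /idealP_is_ideal/hS [c [f hf]]; exists c, f => x; rewrite -hf.
by split=> /asbP.
Qed.

(** The union of the chain is an ideal, and its finitely many generators already lie in one
    member. *)
Lemma noetherian_acc (J : nat -> S -> Prop) :
  (forall m, idealP (J m)) -> (forall m x, J m x -> J m.+1 x) ->
  exists m, forall m' x, J m' x -> J m x.
Proof.
move=> hJ hsub.
have mono m m' x : (m <= m')%N -> J m x -> J m' x.
  by move=> /subnK <-; elim: (m' - m)%N => // k ih /ih/hsub.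
have hU : idealP (fun x => exists m, J m x).
  split=> [|a x y [m hx] [m' hy]]; first by exists 0%N; case: (hJ 0%N).
  exists (maxn m m'); case: (hJ (maxn m m')) => _; apply.
    exact: mono (leq_maxl _ _) hx.
  exact: mono (leq_maxr _ _) hy.
have [c [f hf]] := noetherian_gen hU.
have [m hm] : exists m, forall l, J m (f l).
  apply: all_bounded_nat => [l m m'|l]; first exact: mono.
  by apply/hf/gen_ideal_gen.
exists m => m' x hx; apply: gen_ideal_sub (hJ m) hm _.
by apply/hf; exists m'.
Qed.

(** If every index satisfying [P] could be enlarged strictly, choice would produce a strictly
    ascending chain of ideals. *)
Lemma noetherian_maximal T (J : T -> S -> Prop) (P : T -> Prop) (b0 : T) :
  (forall b, idealP (J b)) -> P b0 ->
  exists2 b, P b & forall b', P b' -> (forall x, J b x -> J b' x) ->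
    forall x, J b' x -> J b x.
Proof.
move=> hJ hb0; apply: NNPP => hno.
have step (b : {b | P b}) : exists b' : {b | P b},
    (forall x, J (sval b) x -> J (sval b') x) /\
    exists x, J (sval b') x /\ ~ J (sval b) x.
  case: b => b hb /=; apply: NNPP => hn; apply: hno; exists b => // b' hb' hs.
  move=> x hx; apply: NNPP => hnx; apply: hn.
  by exists (exist _ b' hb') => /=; split=> //; exists x.
have [F hF] := functional_choice _ step.
have [||m hm] := @noetherian_acc (fun m => J (sval (iter m F (exist _ b0 hb0)))).
- by move=> m; apply: hJ.
- by move=> m x; apply: (hF _).1.
have [x [h1 h2]] := (hF (iter m F (exist _ b0 hb0))).2.
by apply: h2; apply: (hm m.+1).
Qed.

End Ideals.

Section PrimeComplement.
Variables (S : comNzRingType) (q : {pred S}) (hq : is_prime q).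

Lemma prime_add x y : x \in q -> y \in q -> x + y \in q.
Proof. by case: hq => [[_ h] _ _] hx hy; rewrite -[x]mul1r; apply: h. Qed.

Lemma prime_mull a x : x \in q -> a * x \in q.
Proof. by case: hq => [[h0 h] _ _] hx; rewrite -[_ * _]addr0; apply: h. Qed.

Lemma prime_mulr a x : x \in q -> x * a \in q.
Proof. by rewrite mulrC; apply: prime_mull. Qed.

Lemma notin_prime1 : 1 \notin q. Proof. by case: hq. Qed.

Lemma prime0 : 0 \in q. Proof. by case: hq => [[]]. Qed.

Lemma notin_primeM x y : x \notin q -> y \notin q -> x * y \notin q.
Proof.
case: hq => _ _ hp hx hy; apply/negP => /hp.
by rewrite (negPf hx) (negPf hy).
Qed.

Lemma notin_primeX x m : x \notin q -> x ^+ m \notin q.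
Proof.
move=> hx; elim: m => [|m ih]; first by rewrite expr0 notin_prime1.
by rewrite exprS notin_primeM.
Qed.

Lemma notin_prime_prod (I : Type) (r : seq I) (P : pred I) (F : I -> S) :
  (forall i, P i -> F i \notin q) -> \prod_(i <- r | P i) F i \notin q.
Proof.
move=> h; elim/big_ind: _ => //; first exact: notin_prime1.
exact: notin_primeM.
Qed.

Lemma notin_prime_neq0 x : x \notin q -> x != 0.
Proof. by apply: contraNneq => ->; exact: prime0. Qed.

End PrimeComplement.

Section Uniformizer.
Variable A : idomainType.

(* The ideals (g, g y, ..., g y^m) of A become stationary, which yields a monic
   equation for y without a determinant. *)
Lemma integral_of_bounded_powers (y : {fraction A}) (g : A) :
  noetherian A -> g != 0 ->
  (forall m, exists a, FracField.tofrac g * y ^+ m = FracField.tofrac a) ->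
  integralOver (@FracField.tofrac A) y.
Proof.
set F := @FracField.tofrac A => hN g0 hy.
have F0 : F g != 0 by rewrite tofrac_eq0.
have [f hf] := functional_choice _ hy.
pose J m x := gen_ideal (fun l : 'I_m => f l) x.
have hJ m : idealP (J m).
  split; first by exists (fun=> 0); rewrite big1 // => l _; rewrite mul0r.
  move=> a _ _ [u ->] [v ->]; exists (fun l => a * u l + v l).
  rewrite mulr_sumr -big_split /=; apply: eq_bigr => l _.
  by rewrite mulrDl mulrA.
have hsub m x : J m x -> J m.+1 x.
  apply: (gen_ideal_sub (hJ m.+1)) => l.
  exact: (gen_ideal_gen (fun l : 'I_m.+1 => f l) (widen_ord (leqnSn m) l)).
have [m hm] := noetherian_acc hN hJ hsub.
have [u hu] : J m (f m).
  by apply: (hm m.+1); apply: (gen_ideal_gen (fun l : 'I_m.+1 => f l) ord_max).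
(* The relation $f_m=\sum_l u_lf_l$, divided by [g], reads $y^m=\sum_l u_ly^l$; [insub] only turns
   an index into an ordinal. *)
exists ('X^m - \poly_(i < m) (if insub i is Some l then u l else 0)).
  rewrite monicE lead_coefDl ?lead_coefXn // size_polyXn size_polyN.
  by rewrite ltnS size_poly.
rewrite rmorphB /= map_polyXn rootE hornerD hornerN hornerXn subr_eq0.
rewrite (horner_coef_wide _ (n := m)); last first.
  by apply: leq_trans (size_poly _ _) _; apply: size_poly.
apply/eqP/(mulfI F0); rewrite hf hu /F rmorph_sum mulr_sumr /=.
apply: eq_bigr => l _; rewrite coef_map /= coef_poly ltn_ord valK rmorphM.
by rewrite /= -/F -hf mulrCA.
Qed.

Hypothesis hA : dedekind A.
Variable q : {pred A}.
Hypothesis hq : is_prime q.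

(* loc_ideal a b is the ideal (a A_q : b) contracted to A. *)
Let loc_ideal a b (r : A) :=
  exists2 s, s \notin q & exists z, s * (r * b) = a * z.

Let loc_idealP a b : idealP (loc_ideal a b).
Proof.
split; first by exists 1; [exact: notin_prime1 | exists 0; rewrite mul0r !mulr0].
move=> c x y [s hs [z hz]] [s' hs' [z' hz']].
exists (s * s'); first exact: notin_primeM.
exists (s' * c * z + s * z').
transitivity (s' * c * (s * (x * b)) + s * (s' * (y * b))); first by ring.
by rewrite hz hz'; ring.
Qed.

(** For $q\neq 0$, pick $a\neq 0$ in [q] and $b$ such that $(aA_q:b)$ is maximal among the proper
    ideals of this form. Its contraction is prime, hence equal to [q] by dimension one, so that
    $b/a$ maps [q] into $A_q$. If it maps some [t] of [q] to a unit, then [t] is a uniformizer;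
    otherwise integral closedness is violated. The element [s0] is a common denominator for
    generators of [q]. *)
Lemma local_uniformizer : exists t s0, [/\ t \in q, s0 \notin q,
  forall r, r \in q -> exists z, s0 * r = t * z &
  ~ is_zero_ideal q -> t != 0].
Proof.
have [hN hI hD] := hA.
have [q0|q0] := classic (is_zero_ideal q).
  exists 0, 1; split=> //; [exact: prime0 | exact: notin_prime1 |].
  by move=> r /q0 ->; exists 0; rewrite !mulr0.
have [a aq a0] : exists2 a, a \in q & a != 0.
  apply: NNPP => h; apply: q0 => x xq; apply/eqP/negPn/negP => x0.
  by apply: h; exists x.
pose P b := ~ loc_ideal a b 1.
have in_q b r : P b -> loc_ideal a b r -> r \in q.
  move=> hb [s hs [z hz]]; apply/negPn/negP => hr; apply: hb.
  exists (s * r); first exact: notin_primeM.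
  by exists z; rewrite -hz; ring.
have P1 : P 1.
  move=> [s hs [z]]; rewrite !mulr1 => e.
  by move/negP: hs; apply; rewrite e prime_mulr.
have [b hb bmax] := noetherian_maximal hN (loc_idealP a) P1.
have eqJ : [pred r | asb (loc_ideal a b r)] =i q.
  have pr : is_prime [pred r | asb (loc_ideal a b r)].
    split; first exact: idealP_is_ideal.
      by apply/negP => /asbP.
    move=> r r' /asbP hrr; apply/orP.
    have [hr'|hr'] := classic (loc_ideal a b r'); first by right; apply/asbP.
    (* The ideal attached to [r' * b] is proper and contains the one attached to [b], so maximality
       makes them equal; it contains [r]. *)
    left; apply/asbP; apply: (bmax (r' * b)).
    - move=> [s hs [z hz]]; apply: hr'; exists s => //; exists z.
      by rewrite -hz; ring.
    - move=> x [s hs [z hz]]; exists s => //; exists (r' * z).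
      by rewrite (mulrCA a) -hz; ring.
    - case: hrr => s hs [z hz]; exists s => //; exists z.
      by rewrite -hz; ring.
  move=> x; symmetry; apply: (hD _ pr).
  - move=> /(_ a) h; case/eqP: a0; apply: h; apply/asbP.
    by exists 1; [exact: notin_prime1 | exists b; rewrite mul1r].
  - by case: hq.
  - by move=> r /asbP; apply: in_q.
  - exact: notin_prime1.
have hJ r : r \in q -> loc_ideal a b r by rewrite -eqJ => /asbP.
(* Denominators that depend on the element of [q] are replaced by a single one, the product over
   finitely many generators. *)
have fin (Q : A -> A -> Prop) :
    (forall r, r \in q -> exists2 s, s \notin q & Q s r) ->
    (forall s, idealP (Q s)) -> (forall s s' r, Q s r -> Q (s' * s) r) ->
    exists2 s, s \notin q & forall r, r \in q -> Q s r.
  move=> hQ Qi QM; have [|c [f hf]] := hN q; first by case: hq.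
  have hfq l : f l \in q by apply/hf/gen_ideal_gen.
  have [g hg] : exists g : 'I_c -> A, forall l, g l \notin q /\ Q (g l) (f l).
    apply: (functional_choice (fun l s => s \notin q /\ Q s (f l))) => l.
    by have [s] := hQ _ (hfq l); exists s.
  exists (\prod_l g l); first by apply: notin_prime_prod => // l _; case: (hg l).
  move=> r /hf; apply: gen_ideal_sub => // l.
  by rewrite (bigD1 l) //= mulrC; apply: QM; case: (hg l).
have [[t tq [s [w [sq wq e]]]]|hno] := classic (exists2 t, t \in q &
    exists s w, [/\ s \notin q, w \notin q & s * (t * b) = a * w]).
  have [r rq|s1|s1 s' r [z hz]|s1 s1q hs1] :=
      fin (fun s0 r => exists z, s0 * r = t * z).
  - have [s' hs' [w' hw']] := hJ r rq.
    exists (s' * w); first exact: notin_primeM.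
    exists (s * w'); apply: (mulfI a0).
    transitivity (s' * r * (a * w)); first by ring.
    rewrite -e; transitivity (s * t * (s' * (r * b))); first by ring.
    by rewrite hw'; ring.
  - split; first by exists 0; rewrite !mulr0.
    move=> d x y [z hz] [z' hz']; exists (d * z + z').
    transitivity (d * (s1 * x) + s1 * y); first by ring.
    by rewrite hz hz'; ring.
  - by exists (s' * z); rewrite (mulrCA t) -hz; ring.
  - exists t, s1; split=> // _; apply/eqP => t0.
    move: e; rewrite t0 mul0r mulr0 => /esym/eqP.
    by apply/negP; rewrite mulf_neq0 // (notin_prime_neq0 hq).
(* Otherwise b / a maps q into q A_q, hence is integral over A up to a factor
   outside q, which contradicts the choice of b. *)
exfalso; have [r rq|s|s s' r [w wq e]|s hs hst] :=
    fin (fun s r => exists2 w, w \in q & s * (r * b) = a * w).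
- have [s hs [w hw]] := hJ r rq; exists s => //; exists w => //.
  by apply/negPn/negP => wq; apply: hno; exists r => //; exists s, w.
- split; first by exists 0; [exact: prime0 | rewrite mul0r !mulr0].
  move=> d x y [w wq e] [w' wq' e']; exists (d * w + w').
    by apply: prime_add => //; apply: prime_mull.
  transitivity (d * (s * (x * b)) + s * (y * b)); first by ring.
  by rewrite e e'; ring.
- by exists (s' * w); [exact: prime_mull | rewrite -mulrA e; ring].
set F := @FracField.tofrac A; have Fa0 : F a != 0 by rewrite tofrac_eq0.
pose y := F (s * b) / F a.
have hy x : x \in q -> exists2 w, w \in q & F x * y = F w.
  move=> xq; have [w wq e] := hst x xq; exists w => //; apply: (mulIf Fa0).
  by rewrite /y mulrA divfK // -!rmorphM; congr (F _); rewrite [w * a]mulrC -e; ring.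
(* Multiplication by [y] preserves [q], so every $ay^m$ lies in [q], and [a] bounds the denominators
   of all powers of [y]. *)
have [z hz] : exists z, y = F z.
  apply: hI; apply: (integral_of_bounded_powers hN a0) => m.
  suff [w wq e] : exists2 w, w \in q & F a * y ^+ m = F w by exists w.
  elim: m => [|m [w wq e]]; first by exists a; rewrite ?mulr1.
  have [w' wq' e'] := hy w wq; exists w' => //.
  by rewrite exprSr mulrA e.
apply: hb; exists s => //; exists z; rewrite mul1r; apply/eqP.
by rewrite -tofrac_eq -[tofrac _](divfK Fa0) -/F -/y hz -rmorphM mulrC.
Qed.

(** If division by [t] never stopped, quotients $x_m$ with $s_0x_m=tx_{m+1}$ would give an ascending
    chain of ideals $x_mA_q$. Where it becomes stationary, [t] divides an element outside [q], which
    is impossible. *)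
Lemma uniformizer_factor t s0 :
  t \in q -> s0 \notin q -> (forall r, r \in q -> exists z, s0 * r = t * z) ->
  forall a, a != 0 -> exists s m b,
    [/\ s \notin q, b \notin q & s * a = t ^+ m * b].
Proof.
move=> tq s0q hdiv a a0; apply: NNPP => hno; have [hN _ _] := hA.
pose P m x := exists2 s, s \notin q & s * a = t ^+ m * x.
have step m x : P m x -> exists y, s0 * x = t * y /\ P m.+1 y.
  move=> [s sq e]; have [xq|xq] := boolP (x \in q); last first.
    by case: hno; exists s, m, x.
  have [y hy] := hdiv x xq; exists y; split=> //; exists (s0 * s).
    exact: notin_primeM.
  by rewrite -mulrA e mulrCA hy exprSr mulrA.
have nz m x : P m x -> x != 0.
  move=> [s sq e]; apply/eqP => x0; move: e; rewrite x0 mulr0 => /eqP.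
  by apply/negP; rewrite mulf_neq0 // (notin_prime_neq0 hq).
pose T := {p : nat * A | P p.1 p.2}.
have stepT (p : T) : exists p' : T,
    s0 * (sval p).2 = t * (sval p').2.
  case: p => [[m x] /= h]; have [y [e hy]] := step m x h.
  by exists (exist _ (m.+1, y) hy).
have [G hG] := functional_choice _ stepT.
have h0 : P 0%N a by exists 1; [exact: notin_prime1 | rewrite expr0].
pose x m := (sval (iter m G (exist _ (0%N, a) h0))).2.
have hx m : s0 * x m = t * x m.+1 by apply: hG.
have xn0 m : x m != 0.
  by rewrite /x; case: (iter _ _ _) => [[k z]] /= /nz.
(* This is the contraction of $x_mA_q$ to [A]. *)
pose J m r := exists2 s, s \notin q & exists z, s * r = x m * z.
have hJ m : idealP (J m).
  split; first by exists 1; [exact: notin_prime1 | exists 0; rewrite !mulr0].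
  move=> c r r' [s hs [z hz]] [s' hs' [z' hz']].
  exists (s * s'); first exact: notin_primeM.
  exists (s' * c * z + s * z').
  transitivity (s' * c * (s * r) + s * (s' * r')); first by ring.
  by rewrite hz hz'; ring.
have hsub m r : J m r -> J m.+1 r.
  move=> [s hs [z hz]]; exists (s0 * s); first exact: notin_primeM.
  by exists (t * z); rewrite -mulrA hz !mulrA hx; ring.
have [m hm] := noetherian_acc hN hJ hsub.
have [s hs [z hz]] : J m (x m.+1).
  by apply: (hm m.+1); exists 1; [exact: notin_prime1 | exists 1; rewrite mul1r mulr1].
have: s * s0 = t * z.
  apply: (mulIf (xn0 m)); rewrite -mulrA hx.
  by transitivity (t * (s * x m.+1)); [ring | rewrite hz; ring].
by move=> e; have := notin_primeM hq hs s0q; rewrite e prime_mulr.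
Qed.

End Uniformizer.

(** * Graded modules *)

Section LinearOfFun.
Variables (S : nzRingType) (U V : lmodType S) (f : U -> V).

(** The proof is an argument of the alias so that a linear structure can be attached to it. *)
Definition linear_of_fun (hf : linear f) : U -> V := f.

HB.instance Definition _ (hf : linear f) :=
  GRing.isLinear.Build S U V *:%R (linear_of_fun hf) hf.

Lemma ex_linear : linear f -> exists g : {linear U -> V}, forall x, g x = f x.
Proof. by move=> hf; exists (linear_of_fun hf). Qed.

End LinearOfFun.

Section PropSubmodule.
Variables (S : nzRingType) (V : lmodType S).

Record submodule := Submodule {
  submod_mem :> V -> Prop;
  submod_mem0 : submod_mem 0;
  submod_memP : forall a x y,
    submod_mem x -> submod_mem y -> submod_mem (a *: x + y) }.

Variable P : submodule.

Definition submod_pred : {pred V} := [pred x | asb (P x)].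

Fact submod_pred_closed : subsemimod_closed submod_pred.
Proof.
split; first split; first by apply/asbP/submod_mem0.
- move=> x y /asbP hx /asbP hy; apply/asbP; rewrite -[x]scale1r.
  exact: submod_memP.
- move=> a x /asbP hx; apply/asbP; rewrite -[_ *: _]addr0.
  exact: submod_memP hx (submod_mem0 P).
Qed.

HB.instance Definition _ :=
  GRing.isSubmodClosed.Build S V submod_pred submod_pred_closed.

Record submod_type := SubmodType {
  submod_val :> V;
  submod_valP : submod_val \in submod_pred }.

HB.instance Definition _ := [isSub for submod_val].
HB.instance Definition _ := [Choice of submod_type by <:].
HB.instance Definition _ := [SubChoice_isSubLmodule of submod_type by <:].

Lemma submod_val_linear : linear (val : submod_type -> V).
Proof. by move=> a x y; rewrite linearP. Qed.

End PropSubmodule.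

Section GradedTheory.
Variables (A : idomainType) (n : nat).
Notation R := {mpoly A[n]}.
Implicit Types (M N : gradedModule A n) (u v d : zdeg n) (m : 'X_{1..n}).

Lemma mnm_zdegD m1 m2 : mnm_zdeg (m1 + m2)%MM = mnm_zdeg m1 + mnm_zdeg m2.
Proof. by apply/ffunP => j; rewrite !ffunE mnmDE PoszD. Qed.

Lemma mnm_zdeg0 : mnm_zdeg (0%MM : 'X_{1..n}) = 0.
Proof. by apply/ffunP => j; rewrite !ffunE mnm0E. Qed.

Lemma monomial_comp (a : A) m : a *: 'X_[m] \in mpoly_comp A (mnm_zdeg m).
Proof.
apply/mpoly_compP => m' hm'; rewrite mcoeffZ mcoeffX.
by case: (m =P m') hm' => [->|_]; rewrite ?eqxx ?mulr0.
Qed.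

Section Components.
Variable M : gradedModule A n.

Lemma gr_mem0 u : 0 \in gr_comp M u.
Proof. by have [] := gr_zmod (gr_axiom M) u. Qed.

Lemma gr_memB u : {in gr_comp M u &, forall x y, x - y \in gr_comp M u}.
Proof. by have [_ h] := gr_zmod (gr_axiom M) u; exact: h. Qed.

Lemma gr_memN u x : x \in gr_comp M u -> - x \in gr_comp M u.
Proof. by move=> hx; rewrite -sub0r gr_memB // gr_mem0. Qed.

Lemma gr_memD u : {in gr_comp M u &, forall x y, x + y \in gr_comp M u}.
Proof. by move=> x y hx hy; rewrite -[y]opprK gr_memB // gr_memN. Qed.

Lemma gr_memZX u a m x :
  x \in gr_comp M u -> (a *: 'X_[m]) *: x \in gr_comp M (mnm_zdeg m + u).
Proof. by apply: (gr_scale (gr_axiom M)); apply: monomial_comp. Qed.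

Lemma gr_memZC u a x : x \in gr_comp M u -> a%:MP *: x \in gr_comp M u.
Proof.
move=> hx; rewrite -[u]add0r -mnm_zdeg0 -[a%:MP]mulr1 -mpolyX0 mul_mpolyC.
exact: gr_memZX.
Qed.

Lemma gr_split u x : exists s (y : zdeg n -> M),
  [/\ uniq s, u \in s, forall v, y v \in gr_comp M v & x = \sum_(v <- s) y v].
Proof.
have [s [w [hw ->]]] := gr_span (gr_axiom M) x.
(* A degree listed several times contributes its element once per occurrence, and [u], if it was
   absent, gets the component 0. *)
exists (undup (u :: s)), (fun v => w v *+ count_mem v s); split=> [||v|].
- exact: undup_uniq.
- by rewrite mem_undup inE eqxx.
- elim: (count_mem v s) => [|c ih]; first by rewrite mulr0n gr_mem0.
  by rewrite mulrS gr_memD.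
have hs : {subset s <= undup (u :: s)}.
  by move=> v hv; rewrite mem_undup inE hv orbT.
elim: s (undup _) (undup_uniq (u :: s)) hs {hw} => [|v s ih] s' us' hs.
  by rewrite big_nil big1.
rewrite big_cons (ih s' us') => [|v' hv']; last by apply: hs; rewrite inE hv' orbT.
have vs' : v \in s' by apply: hs; rewrite inE eqxx.
rewrite !(bigD1_seq v vs' us') /= eqxx mulrS -addrA; congr (_ + (_ + _)).
by apply: eq_bigr => v' /negPf hv'; rewrite eq_sym hv'.
Qed.

End Components.

(* y is the component of x in degree u. *)
Lemma homogeneous_part M u (x : M) : exists2 y, y \in gr_comp M u &
  forall N (g : {linear M -> N}) d,
    (forall v z, z \in gr_comp M v -> g z \in gr_comp N (d + v)) ->
    g x \in gr_comp N (d + u) -> g x = g y.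
Proof.
have [s [y [us hu hy ->]]] := gr_split u x.
exists (y u) => // N g d hg; rewrite (bigD1_seq u) //= raddfD /= => hx.
rewrite -[RHS]addr0; congr (_ + _).
set z := \sum_(v <- s | _) _; have hz : g z \in gr_comp N (d + u).
  have -> : g z = g (y u) + g z - g (y u) by rewrite addrAC subrr add0r.
  by apply: gr_memB => //; apply: hg.
(* [Y] collects the components of $g(z)$, none of which has degree $d+u$, together with $-g(z)$ in
   degree $d+u$. They add up to zero, so directness of the grading forces $g(z)=0$. *)
pose Y v := if v == d + u then - g z else g (y (v - d)).
suff : Y (d + u) = 0 by rewrite /Y eqxx => /eqP; rewrite oppr_eq0 => /eqP.
apply: (gr_direct (gr_axiom N) (s := [seq d + v | v <- s]) (y := Y)).
- by rewrite map_inj_uniq //; apply: addrI.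
- move=> v; rewrite /Y; case: eqP => [->|_]; first exact: gr_memN.
  by have := hg (v - d) _ (hy (v - d)); rewrite [d + _]addrC subrK.
- rewrite big_map (bigD1_seq u) //= {1}/Y eqxx raddf_sum /= addrC.
  apply/eqP; rewrite subr_eq0; apply/eqP; apply: eq_bigr => v hv.
  by rewrite /Y (inj_eq (addrI d)) (negPf hv) addrAC subrr add0r.
- exact: map_f.
Qed.

(** With this sign, an element of degree $u$ in [M] acquires degree $u+d$. *)
Definition shift_comp M d (u : zdeg n) : {pred M} := gr_comp M (u - d).

Arguments shift_comp M d u : clear implicits.

Lemma shift_grading M d : is_grading (shift_comp M d).
Proof.
have [h1 h2 h3 h4] := gr_axiom M.
split=> [u|u v p x hp hx|x|s y us hy e u hu].
- exact: h1.
- by rewrite /shift_comp -addrA h2.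
- have [s [y [hy ->]]] := h3 x.
  exists [seq v + d | v <- s], (fun v => y (v - d)); split=> [v|]; first exact: hy.
  by rewrite big_map; apply: eq_bigr => v _; rewrite addrK.
- rewrite -[u](subrK d).
  apply: (h4 [seq v - d | v <- s] (fun v => y (v + d))).
  + by rewrite map_inj_uniq //; apply: addIr.
  + by move=> v; have := hy (v + d); rewrite /shift_comp addrK.
  + by rewrite big_map -[RHS]e; apply: eq_bigr => v _; rewrite subrK.
  + by apply/mapP; exists u.
Qed.

Definition shift_graded M d : gradedModule A n := GradedModule (shift_grading M d).

Section SubGraded.
Variables (M : gradedModule A n) (P : submodule M).
Hypothesis hP : forall x, P x -> exists (s : seq (zdeg n)) (y : zdeg n -> M),
  (forall u, y u \in gr_comp M u /\ P (y u)) /\ x = \sum_(u <- s) y u.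

Definition sub_comp (u : zdeg n) : {pred submod_type P} :=
  [pred x | val x \in gr_comp M u].

Lemma sub_grading : is_grading sub_comp.
Proof.
have [h1 h2 h3 h4] := gr_axiom M.
split=> [u|u v p x hp hx|x|s y us hy e u hu].
- by split=> [|x y hx hy]; rewrite inE ?raddf0 ?raddfB ?gr_mem0 ?gr_memB.
- by rewrite inE linearZ; apply: h2.
- have [s [y [hy e]]] := hP (asbP _ (submod_valP x)).
  exists s, (fun u => SubmodType (introT (asbP _) (hy u).2)); split=> [u|].
    by rewrite inE; case: (hy u).
  by apply: val_inj; rewrite raddf_sum.
- apply: val_inj; rewrite raddf0; apply: (h4 s (fun u => val (y u))) => //.
  by rewrite -raddf_sum e raddf0.
Qed.

Definition sub_graded : gradedModule A n := GradedModule sub_grading.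

End SubGraded.

End GradedTheory.

(** * Division in graded injective modules *)

Section GradedDivision.
Variables (A : idomainType) (n : nat).
Notation R := {mpoly A[n]}.

Lemma mcoeffMX_sub (p : R) (U m : 'X_{1..n}) :
  (p * 'X_[U])@_m = if (U <= m)%MM then p@_(m - U) else 0.
Proof.
case: ifP => [Um|/negP Um].
  by rewrite -{1}(submK Um) addmC mcoeffMX.
rewrite {1}[p]mpolyE mulr_suml raddf_sum big1 //= => m' _.
rewrite -scalerAl -mpolyXD mcoeffZ mcoeffX; case: eqP => [e|_]; last by rewrite mulr0.
by case: Um; rewrite -e lem_addl.
Qed.

(** The projection of [R] onto multidegree [u]; at most one term survives because [mnm_zdeg] is
    injective. *)
Definition pcomp (u : zdeg n) (p : R) : R :=
  \sum_(m <- msupp p | mnm_zdeg m == u) p@_m *: 'X_[m].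

Lemma mcoeff_pcomp u p m : (pcomp u p)@_m = if mnm_zdeg m == u then p@_m else 0.
Proof.
rewrite /pcomp raddf_sum /=.
under eq_bigr => m' _ do rewrite mcoeffZ mcoeffX.
have [mp|mp] := boolP (m \in msupp p); last first.
  rewrite big_seq_cond big1 => [|m' /andP [hm' _]].
    by rewrite (memN_msupp_eq0 mp) if_same.
  by case: eqP hm' => [->|_ _]; [rewrite (negPf mp) | rewrite mulr0].
rewrite big_mkcond (bigD1_seq m) //= eqxx mulr1 big1 ?addr0 // => m' /negPf hm'.
by rewrite hm' mulr0 if_same.
Qed.

Lemma pcomp_comp u p : pcomp u p \in mpoly_comp A u.
Proof. by apply/mpoly_compP => m /negPf hm; rewrite mcoeff_pcomp hm. Qed.

Lemma pcomp_id u p : p \in mpoly_comp A u -> pcomp u p = p.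
Proof.
move=> /mpoly_compP h; apply/mpolyP => m; rewrite mcoeff_pcomp.
by case: eqP => // /eqP/h ->.
Qed.

Lemma pcompD u p p' : pcomp u (p + p') = pcomp u p + pcomp u p'.
Proof.
apply/mpolyP => m; rewrite mcoeffD !mcoeff_pcomp mcoeffD.
by case: eqP => // _; rewrite addr0.
Qed.

Lemma pcompMX u (p : R) a (U : 'X_{1..n}) :
  pcomp u (p * (a *: 'X_[U])) = pcomp (u - mnm_zdeg U) p * (a *: 'X_[U]).
Proof.
apply/mpolyP => m.
rewrite mcoeff_pcomp -!scalerAr !mcoeffZ !mcoeffMX_sub mcoeff_pcomp.
case: (boolP (U <= m)%MM) => [Um|_]; last by rewrite mulr0 if_same.
rewrite -[in RHS](inj_eq (addIr (mnm_zdeg U))) subrK -mnm_zdegD submK //.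
by case: ifP => // _; rewrite mulr0.
Qed.

Lemma pcomp_sum p : p = \sum_(u <- [seq mnm_zdeg m | m <- msupp p]) pcomp u p.
Proof.
rewrite big_map {1}[p]mpolyE; apply: eq_big_seq => m mp.
rewrite /pcomp (eq_bigl (pred1 m)); last first.
  by move=> m'; rewrite (inj_eq (@mnm_zdeg_inj n)).
by rewrite -big_filter filter_pred1_uniq // big_seq1.
Qed.

Variables (E : gradedModule A n) (hE : graded_injective E).
(* b m is the ideal of coefficients of 'X_[m] in a monomial ideal of R. *)
Variables (b : 'X_{1..n} -> A -> Prop) (a : A) (U : 'X_{1..n}) (v : zdeg n)
  (x : E).
Hypotheses (b0 : forall m, b m 0)
  (bD : forall m r r', b m r -> b m r' -> b m (r + r'))
  (bM : forall m r r', b m r' -> b m (r * r'))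
  (bX : forall m m' r, b m r -> b (m' + m)%MM r).
Hypothesis hx : x \in gr_comp E (mnm_zdeg U + v).
Hypothesis hb :
  forall m r, b (U + m)%MM (a * r) -> (r *: 'X_[m]) *: x = 0.

Let J0 (p : R) := forall m, b m p@_m.
Let f : R := a *: 'X_[U].

Let J0D p p' : J0 p -> J0 p' -> J0 (p + p').
Proof. by move=> h h' m; rewrite mcoeffD; apply: bD. Qed.

Let J0M (p p' : R) : J0 p' -> J0 (p * p').
Proof.
move=> h m; rewrite [p]mpolyE mulr_suml raddf_sum /=.
elim/big_ind: _ => //; first exact: bD.
move=> m' _; rewrite -scalerAl mulrC mcoeffZ mcoeffMX_sub; apply: bM.
case: ifP => [Um|_]; last exact: b0.
by rewrite -{1}(submK Um) addmC; apply: bX.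
Qed.

Let J0N p : J0 p -> J0 (- p).
Proof. by move=> h; rewrite -mulN1r; apply: J0M. Qed.

Let J0pcomp u p : J0 p -> J0 (pcomp u p).
Proof. by move=> h m; rewrite mcoeff_pcomp; case: ifP. Qed.

Let J0f (r : R) : J0 (r * f) -> r *: x = 0.
Proof.
move=> h; rewrite [r]mpolyE scaler_suml big1 // => m _; apply: hb.
by have := h (U + m)%MM; rewrite -scalerAr mcoeffZ mcoeffMX.
Qed.

Let J (p : R^o) := exists r w : R, J0 w /\ p = r * f + w :> R.

Let J_closed (c : R) p p' : J p -> J p' -> J (c *: p + p').
Proof.
move=> [r [w [hw ->]]] [r' [w' [hw' ->]]].
exists (c * r + r'), (c * w + w'); split; first by apply: J0D => //; apply: J0M.
by rewrite /GRing.scale /=; ring.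
Qed.

Let J00 : J0 0. Proof. by move=> m; rewrite mcoeff0. Qed.

Let J_0 : J 0.
Proof. by exists 0, 0; rewrite mul0r addr0. Qed.

Let N := shift_graded (mpoly_graded A n) v.

Let JS : submodule N := Submodule J_0 J_closed.

Let JS_graded p : JS p -> exists (s : seq (zdeg n)) (y : zdeg n -> N),
  (forall u, y u \in gr_comp N u /\ JS (y u)) /\ p = \sum_(u <- s) y u.
Proof.
move=> [r [w [hw e]]].
exists [seq u + v | u <- [seq mnm_zdeg m | m <- msupp (p : R)]].
exists (fun u => pcomp (u - v) p); split=> [u|]; last first.
  by rewrite big_map {1}[p]pcomp_sum; apply: eq_bigr => u _; rewrite addrK.
split; first exact: pcomp_comp.
exists (pcomp (u - v - mnm_zdeg U) r), (pcomp (u - v) w).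
by split; [exact: J0pcomp | rewrite [p in LHS]e pcompD pcompMX].
Qed.

Let MJ := sub_graded JS_graded.

(** The assignment $rf+w\mapsto rx$ on the graded ideal $Rf+J_0$ is well defined by [hb], and
    homogeneous once $1\in R$ is given degree [v]. Graded injectivity extends it to all of [R], and
    [y] is the image of 1. *)
Lemma graded_division : exists2 y, y \in gr_comp E v &
  (a *: 'X_[U]) *: y = x /\ forall m r, b m r -> (r *: 'X_[m]) *: y = 0.
Proof.
have hr (z : submod_type JS) : exists r : R, exists2 w : R, J0 w & val z = r * f + w :> R.
  by have /asbP [r [w [hw e]]] := submod_valP z; exists r, w.
have [r hr'] := functional_choice _ hr.
(* The chosen [r z] is not unique, but [r z *: x] is: two choices differ by an element of $(J_0:f)$,
   which kills [x]. *)
have r_unique (p w w' : R) (z : submod_type JS) :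
    J0 w -> J0 w' -> val z + w = p * f + w' :> R -> r z *: x = p *: x.
  move=> hw hw' e; apply/eqP; rewrite -subr_eq0 -scalerBl; apply/eqP/J0f.
  have [w'' hw'' e''] := hr' z; rewrite e'' in e.
  have -> : (r z - p) * f = (r z * f + w'' + w) - p * f - w'' - w by ring.
  have -> : r z * f + w'' + w - p * f - w'' - w = w' - w'' - w by rewrite e; ring.
  by apply: J0D; [apply: J0D => //|]; apply: J0N.
have hlin : linear (fun z : submod_type JS => r z *: x).
  move=> c z z'; have [w hw e] := hr' z; have [w' hw' e'] := hr' z'.
  rewrite scalerA -scalerDl; apply: (r_unique _ 0 (c * w + w')) => //.
    by apply: J0D => //; apply: J0M.
  by rewrite addr0 linearP /= e e' /GRing.scale /=; ring.
have [F hF] := ex_linear hlin.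
have [g hg] := ex_linear (@submod_val_linear _ _ JS).
have [||z z'|h hh heq] := hE (M := MJ) (N := N) (g := g) (f := F).
- by move=> u z hz; rewrite hg.
- move=> u z hz; rewrite hF; have [w hw e] := hr' z.
  have {}hz : val z \in mpoly_comp A (u - v) by exact: hz.
  rewrite (r_unique (pcomp (u - v - mnm_zdeg U) (r z)) 0 (pcomp (u - v) w)) //.
  + have := gr_scale (gr_axiom E) (pcomp_comp (u - v - mnm_zdeg U) (r z)) hx.
    by rewrite addrA subrK subrK.
  + exact: J0pcomp.
  + by rewrite addr0 -pcompMX -pcompD -e pcomp_id.
- by rewrite !hg; apply: val_inj.
have hJ (p : N) : JS p -> exists2 z : submod_type JS, h p = F z & val z = p.
  move=> hp; exists (SubmodType (introT (asbP _) hp)) => //.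
  by rewrite -heq hg.
exists (h (1 : R)).
  apply: hh; change ((1 : R) \in mpoly_comp A (v - v)).
  by rewrite subrr -(mnm_zdeg0 n) -[1]scale1r -mpolyX0 monomial_comp.
have hs (p : R) : p *: h (1 : R) = h (p : N).
  by rewrite -linearZ /= /GRing.scale /= mulr1.
split=> [|m s hms]; rewrite hs.
  have [|z -> ez] := hJ f; first by exists 1, 0; rewrite mul1r addr0.
  rewrite hF -[RHS]scale1r; apply: (r_unique _ 0 0) => //.
  by rewrite ez mul1r.
have J0s : J0 (s *: 'X_[m]).
  by move=> m'; rewrite mcoeffZ mcoeffX; case: eqP => [<-|_]; rewrite ?mulr1 ?mulr0.
have [|z -> ez] := hJ (s *: 'X_[m]); first by exists 0, (s *: 'X_[m]); rewrite mul0r add0r.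
rewrite hF -[RHS](scale0r x); apply: (r_unique _ 0 (s *: 'X_[m])) => //.
by rewrite ez mul0r addr0 add0r.
Qed.

End GradedDivision.

Arguments graded_division {A n E} hE b a U v x.

(** * Dimension bounds for the cohomology of torsion *)

Section DependencyBound.
Variables (A : idomainType) (n : nat) (q : {pred A}) (hq : is_prime q).
Notation R := {mpoly A[n]}.

Section Dependency.
Variable V : lmodType R.
Implicit Types (Z B : V -> Prop) (x : V).

Definition killed x := forall a, a \in q -> a%:MP *: x = 0.

(* When Z / B is killed by q, its localization at q has dimension at most r
   over the residue field k(q). *)
Definition dep_le Z B r := forall x : 'I_r.+1 -> V, (forall i, Z (x i)) ->
  exists c : 'I_r.+1 -> A,
    (exists i, c i \notin q) /\ B (\sum_i (c i)%:MP *: x i).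

(** Only $r+1$ elements of [D] enter the relation; the others get coefficient 0. *)
Lemma dep_le_finset Z B r (T : finType) (D : {set T}) (x : T -> V) :
  dep_le Z B r -> (r < #|D|)%N -> (forall i, i \in D -> Z (x i)) ->
  exists c : T -> A, (exists2 i, i \in D & c i \notin q) /\
    B (\sum_(i in D) (c i)%:MP *: x i).
Proof.
move=> h hr hx; pose e k := enum_val (widen_ord hr k).
have eD k : e k \in D by apply: enum_valP.
have e_inj : injective e by move=> k k' /enum_val_inj/(congr1 val) /= /val_inj.
have [|c [[k hk] hB]] := h (x \o e); first by move=> k; apply: hx.
exists (fun i => \sum_(k | e k == i) c k); split.
  exists (e k) => //; rewrite (eq_bigl (pred1 k)) ?big_pred1_eq // => k'.
  by rewrite /= (inj_eq e_inj).
suff -> : \sum_(i in D) (\sum_(k | e k == i) c k)%:MP *: x i =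
          \sum_k (c k)%:MP *: x (e k) by [].
rewrite (partition_big e (mem D)) //=; apply: eq_bigr => i _.
rewrite raddf_sum scaler_suml; apply: eq_bigr => k' /eqP <- //.
Qed.

Lemma dep_le_mono Z B r r' : (r <= r')%N -> dep_le Z B r -> dep_le Z B r'.
Proof.
move=> hr h x hx.
have [||c [[i _ hi] hB]] := dep_le_finset (D := setT) (x := x) h.
- by rewrite cardsT card_ord.
- by move=> i _.
exists c; split; first by exists i.
by rewrite (eq_bigl _ _ (fun i => in_setT i)) in hB.
Qed.

(** This is additivity of dimension along [B']. A maximal set [I] of indices independent modulo [B']
    has at most [r2] elements. Each of the more than [r1] remaining indices yields a combination in
    [B'], and a relation between these combinations modulo [B] is expanded in terms of [x]. *)
Lemma dep_le_add Z B' B r1 r2 :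
  (forall x, Z x -> killed x) ->
  (forall a x y, Z x -> Z y -> Z (a%:MP *: x + y)) -> Z 0 ->
  dep_le Z B' r2 -> dep_le (fun x => Z x /\ B' x) B r1 -> dep_le Z B (r1 + r2).
Proof.
move=> Zk Zlin Z0 h2 h1 x hx.
have Zsum (T : finType) (D : {set T}) (c : T -> A) (y : T -> V) :
    (forall i, Z (y i)) -> Z (\sum_(i in D) (c i)%:MP *: y i).
  move=> hy; elim/big_ind: _ => // [u v hu hv|i _].
    by have := Zlin 1 _ _ hu hv; rewrite mpolyC1 scale1r.
  by rewrite -[_ *: _]addr0; apply: Zlin.
pose indep (I : {set 'I_(r1 + r2).+1}) := forall c : _ -> A,
  B' (\sum_(i in I) (c i)%:MP *: x i) -> forall i, i \in I -> c i \in q.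
have hI0 : asb (indep set0) by apply/asbP => c _ i; rewrite inE.
have [I /asbP hI Imax] := @arg_maxnP _ set0 (fun I => asb (indep I)) (fun I => #|I|) hI0.
have Ile : (#|I| <= r2)%N.
  rewrite leqNgt; apply/negP => lt.
  have [//|c [[i iI /negP ci] hB]] := dep_le_finset (x := x) h2 lt.
  by apply: ci; apply: hI.
have Dlt : (r1 < #|~: I|)%N.
  have := cardsC I; rewrite card_ord => e.
  by rewrite -(ltn_add2l #|I|) e ltnS addnC leq_add2l.
have hc j : exists c : _ -> A, j \in ~: I ->
    c j \notin q /\ B' (\sum_(i in j |: I) (c i)%:MP *: x i).
  have [jI|jI] := boolP (j \in ~: I); last by exists (fun=> 0).
  rewrite inE in jI; apply: NNPP => hno.
  have : asb (indep (j |: I)).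
    apply/asbP => c hB i iI; have cj : c j \in q.
      by apply/negPn/negP => cj; case: hno; exists c.
    move: iI; rewrite in_setU1 => /predU1P [-> //|]; apply: hI.
    (* The term of [j] vanishes because [c j] lies in [q] and [Z] is killed by [q]. *)
    by move: hB; rewrite big_setU1 //= (Zk _ (hx j)) // add0r.
  by move=> /Imax /=; rewrite cardsU1 jI /= ltnn.
have {hc} [c hc] := functional_choice _ hc.
pose z j := \sum_(i in j |: I) (c j i)%:MP *: x i.
have [|e [[j jD ej] hB]] := dep_le_finset (x := z) h1 Dlt.
  by move=> j /hc [_ hB]; split=> //; apply: Zsum.
(* For [i] outside [I] only the summand [j = i] contributes, so [C j] is [e j * c j j], a product of
   elements outside [q]. *)
pose C i := \sum_(j in ~: I) e j * (if i \in j |: I then c j i else 0).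
exists C; split.
  exists j; rewrite /C (bigD1 j) //= setU11 big1 ?addr0 => [|j' /andP [_ /negPf hj]].
    by apply: notin_primeM => //; case: (hc j jD).
  by move: jD; rewrite inE in_setU1 eq_sym hj => /negPf ->; rewrite mulr0.
suff -> : \sum_i (C i)%:MP *: x i = \sum_(j in ~: I) (e j)%:MP *: z j by [].
rewrite (eq_bigr (fun i => \sum_(j in ~: I)
    (e j * (if i \in j |: I then c j i else 0))%:MP *: x i)); last first.
  by move=> i _; rewrite /C raddf_sum scaler_suml.
rewrite exchange_big /=; apply: eq_bigr => k _; rewrite /z scaler_sumr.
rewrite [RHS]big_mkcond /=; apply: eq_bigr => i _.
by case: ifP => _; rewrite ?mulr0 ?mpolyC0 ?scale0r // scalerA mpolyCM.
Qed.

End Dependency.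

Definition cmonom (f : A * 'X_{1..n}) : R := f.1 *: 'X_[f.2].

Lemma cmonomX f N : cmonom f ^+ N = f.1 ^+ N *: 'X_[f.2 *+ N].
Proof. by rewrite /cmonom exprZn mpolyXn. Qed.

Lemma mpolyCE_X (a : A) : a%:MP = a *: 'X_[0] :> R.
Proof. by rewrite mpolyX0 -mul_mpolyC mulr1. Qed.

(** Torsion is tested on each generator separately, which allows induction on the list;
    [torsion_ftor] identifies it with torsion for the generated ideal. *)
Definition ftor (fs : seq (A * 'X_{1..n})) (V : lmodType R) (x : V) :=
  forall f, f \in fs -> exists N, cmonom f ^+ N *: x = 0.

Lemma ftor_bound fs (V : lmodType R) (x : V) : ftor fs x ->
  exists N, forall f, f \in fs -> forall N', (N <= N')%N -> cmonom f ^+ N' *: x = 0.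
Proof.
move=> h; have [f|f|N hN] := @all_bounded_nat (seq_sub fs)
    (fun f N => forall N', (N <= N')%N -> cmonom (ssval f) ^+ N' *: x = 0).
- by move=> m m' hm hf N' hN'; apply: hf; apply: leq_trans hN'.
- have [N hN] := h _ (ssvalP f); exists N => N' /subnK <-.
  by rewrite exprD -scalerA hN scaler0.
by exists N => f hf; apply: (hN (SeqSub hf)).
Qed.

Lemma ftorP fs (V : lmodType R) r (x y : V) :
  ftor fs x -> ftor fs y -> ftor fs (r *: x + y).
Proof.
move=> hx hy f hf; have [N hN] := hx f hf; have [N' hN'] := hy f hf.
exists (N + N')%N; rewrite scalerDr scalerA exprD -[_ *: y]scalerA hN'.
have -> : cmonom f ^+ N * cmonom f ^+ N' * r = r * cmonom f ^+ N' * cmonom f ^+ N.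
  by ring.
by rewrite -scalerA hN !scaler0 addr0.
Qed.

Lemma ftor0 fs (V : lmodType R) : ftor fs (0 : V).
Proof. by move=> f _; exists 0%N; rewrite scaler0. Qed.

Lemma ftorZ fs (V : lmodType R) r (x : V) : ftor fs x -> ftor fs (r *: x).
Proof. by move=> hx; rewrite -[_ *: _]addr0; apply: ftorP => //; apply: ftor0. Qed.

Lemma killedP (V : lmodType R) r (x y : V) :
  killed x -> killed y -> killed (r *: x + y).
Proof.
by move=> hx hy a aq; rewrite scalerDr hy // addr0 scalerA mulrC -scalerA hx ?scaler0.
Qed.

Lemma killed0 (V : lmodType R) : killed (0 : V).
Proof. by move=> a _; rewrite scaler0. Qed.

Variables (E : gradedModule A n) (hE : graded_injective E).

(** The lemma [graded_division] is applied with the monomial ideal generated by [q] and by the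
    powers $U_g^N$ for the generators $g=a_gU_g$ with $a_g\notin q$. A generator with coefficient in
    [q] kills [y] anyway. *)
Lemma killed_division fs f v (x : E) :
  f.1 \notin q -> x \in gr_comp E (mnm_zdeg f.2 + v) -> killed x -> ftor fs x ->
  exists2 s, s \notin q & exists y, [/\ y \in gr_comp E v, killed y, ftor fs y &
    cmonom f *: y = s%:MP *: x].
Proof.
case: f => a U /= aq hx kx /ftor_bound [T hT].
(* This exponent is large enough that $U_g^N\mid U\cdot X^m$ implies $U_g^T\mid X^m$. *)
pose N := (T + mdeg U)%N.
pose b m (r : A) := r \in q \/
  exists2 g, g \in fs & g.1 \notin q /\ (g.2 *+ N <= m)%MM.
(* The factor $a_g^T$ of [s] completes $U_g^T$ to $g^T$, which kills [x]. *)
pose s := \prod_(g <- fs | g.1 \notin q) g.1 ^+ T.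
have sq : s \notin q by apply: notin_prime_prod => // g; apply: notin_primeX.
exists s => //.
have [||||||y hy [e hb]] := graded_division hE b a U v (s%:MP *: x).
- by move=> m; left; apply: prime0.
- move=> m r r' [hr|h] hr'; last by right.
  by case: hr' => [hr'|h']; [left; apply: prime_add | right].
- by move=> m r r' [hr|h]; [left; apply: prime_mull | right].
- move=> m m' r [hr|[g gs [gq hg]]]; [by left | right; exists g => //; split=> //].
  by apply: lepm_trans hg _; apply: lem_addl.
- exact: gr_memZC.
- move=> m r [har|[g gs [gq hg]]].
    have rq : r \in q.
      by case: hq => _ _ hp; have := hp _ _ har; rewrite (negPf aq).
    rewrite scalerA -mul_mpolyC -mulrA mulrC -scalerA; rewrite kx ?scaler0 //.
  have hm : (g.2 *+ T <= m)%MM.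
    apply/mnm_lepP => i; move/mnm_lepP/(_ i): hg.
    rewrite mnmDE !mulmnE /N mulnDr => h.
    have [->|gi] := posnP (g.2 i); first by rewrite mul0n.
    rewrite -(leq_add2l (U i)); apply: leq_trans h; rewrite addnC leq_add2l.
    apply: leq_trans (leq_pmull _ gi); rewrite mdegE (bigD1 i) //=.
    exact: leq_addr.
  rewrite /s (big_rem g) //= gq -[in 'X_[m]](submK hm) mpolyXD scalerA.
  have -> z : (r *: ('X_[m - g.2 *+ T] * 'X_[g.2 *+ T])) * (g.1 ^+ T * z)%:MP =
      (r *: 'X_[m - g.2 *+ T] * z%:MP) * cmonom g ^+ T.
    rewrite cmonomX -!mul_mpolyC mpolyCM; ring.
  by rewrite -scalerA hT // scaler0.
exists y; split=> //.
- by move=> c cq; rewrite mpolyCE_X; apply: hb; left.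
- move=> g gs; have [gq|gq] := boolP (g.1 \in q).
    by exists 1%N; rewrite expr1; apply: hb; left.
  exists N; rewrite cmonomX; apply: hb; right; exists g => //; split=> //.
  exact: lepm_refl.
Qed.

(** Up to factors outside [q], the coefficient of each generator $g$ is a power $t^{\mu_g}$. The
    division is by the constant [t], relative to the monomial ideal generated by all
    $t^{\mu_gN}U_g^N$. *)
Lemma uniformizer_division (t : A) fs v (x : E) :
  t != 0 -> (forall a, a != 0 -> exists s m b,
    [/\ s \notin q, b \notin q & s * a = t ^+ m * b]) ->
  (forall f, f \in fs -> f.1 != 0) ->
  x \in gr_comp E v -> ftor fs x ->
  exists2 s, s \notin q & exists y, [/\ y \in gr_comp E v, ftor fs y &
    t%:MP *: y = s%:MP *: x].
Proof.
move=> t0 hfact hfs hx /ftor_bound [T hT].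
have [w hw] : exists w : A -> A * nat * A, forall a, a != 0 ->
    [/\ (w a).1.1 \notin q, (w a).2 \notin q &
        (w a).1.1 * a = t ^+ (w a).1.2 * (w a).2].
  apply: (functional_choice (fun a (w : A * nat * A) => a != 0 ->
    [/\ w.1.1 \notin q, w.2 \notin q & w.1.1 * a = t ^+ w.1.2 * w.2])) => a.
  have [->|/hfact [s [m [b h]]]] := eqVneq a 0; first by exists (0, 0%N, 0).
  by exists (s, m, b).
pose sg (g : A * 'X_{1..n}) := (w g.1).1.1.
pose mu (g : A * 'X_{1..n}) := (w g.1).1.2.
pose be (g : A * 'X_{1..n}) := (w g.1).2.
have hg g : g \in fs -> [/\ sg g \notin q, be g \notin q &
    sg g * g.1 = t ^+ mu g * be g] by move=> gs; apply/hw/hfs.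
(* One extra power makes up for the division by [t]: if $tr$ is a multiple of $t^{\mu_gN}$, then [r]
   is a multiple of $t^{\mu_gT}$. *)
pose N := T.+1.
pose b m (r : A) := r = 0 \/ exists2 g, g \in fs &
  (g.2 *+ N <= m)%MM /\ exists z, r = t ^+ (mu g * N) * z.
(* The factor [s1] turns $t^{\mu_gT}U_g^T$ into a multiple of $g^T$ before the division; [s2] turns
   $g^N$ into a multiple of $t^{\mu_gN}U_g^N$ after it. *)
pose s1 := \prod_(g <- fs) be g ^+ T.
pose s2 := \prod_(g <- fs) sg g ^+ N.
have s1q : s1 \notin q.
  rewrite /s1 big_seq; apply: notin_prime_prod => // g /hg [_ h _].
  exact: notin_primeX.
have s2q : s2 \notin q.
  rewrite /s2 big_seq; apply: notin_prime_prod => // g /hg [h _ _].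
  exact: notin_primeX.
exists (s2 * s1); first exact: notin_primeM.
have [||||||y hy [e hb]] := graded_division hE b t 0%MM v (s1%:MP *: x).
- by move=> m; left.
- move=> m r r' [->|[g gs [hm [z ->]]]]; first by rewrite add0r.
  move=> [->|[g' gs' [hm' [z' ->]]]].
    by rewrite addr0; right; exists g => //; split=> //; exists z.
  (* Powers of [t] are comparable, so the sum is a multiple of the smaller one. *)
  right; case: (leqP (mu g) (mu g')) => [|/ltnW] hmu.
    exists g => //; split=> //; exists (z + t ^+ ((mu g' - mu g) * N) * z').
    by rewrite mulrDr mulrA -exprD -mulnDl subnKC.
  exists g' => //; split=> //; exists (t ^+ ((mu g - mu g') * N) * z + z').
  by rewrite mulrDr mulrA -exprD -mulnDl subnKC.
- move=> m r r' [->|[g gs [hm [z ->]]]]; first by left; rewrite mulr0.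
  by right; exists g => //; split=> //; exists (r * z); rewrite mulrCA.
- move=> m m' r [->|[g gs [hm hz]]]; [by left | right; exists g => //; split=> //].
  by apply: lepm_trans hm _; apply: lem_addl.
- by rewrite mnm_zdeg0 add0r; apply: gr_memZC.
- move=> m r; rewrite add0m => -[/eqP|[g gs [hgm [z ez]]]].
    rewrite mulf_eq0 (negPf t0) /= => /eqP ->.
    by rewrite scale0r scale0r.
  have [z' ->] : exists z', r = t ^+ (mu g * T) * z'.
    move: ez; case: (mu g) => [|k] ez; first by exists r; rewrite mul0n mul1r.
    exists (t ^+ k * z); apply: (mulfI t0); rewrite ez !mulrA -exprS -exprD.
    by congr (t ^+ _ * z); rewrite /N mulnS; lia.
  have hm : (g.2 *+ T <= m)%MM.
    apply: lepm_trans hgm; apply/mnm_lepP => i.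
    by rewrite !mulmnE leq_mul2l leqnSn orbT.
  have [_ _ hs] := hg g gs.
  rewrite /s1 (big_rem g) //= -[in 'X_[m]](submK hm) mpolyXD scalerA.
  have -> p : ((t ^+ (mu g * T) * z') *: ('X_[m - g.2 *+ T] * 'X_[g.2 *+ T])) *
      (be g ^+ T * p)%:MP =
      (z' *: 'X_[m - g.2 *+ T] * (p * sg g ^+ T)%:MP) * cmonom g ^+ T.
    have hs' : (sg g ^+ T)%:MP * (g.1 ^+ T)%:MP =
        (t ^+ (mu g * T))%:MP * (be g ^+ T)%:MP :> R.
      by rewrite -!mpolyCM -exprMn hs exprMn exprM.
    rewrite cmonomX -!mul_mpolyC !mpolyCM.
    transitivity (z'%:MP * 'X_[m - g.2 *+ T] * p%:MP * 'X_[g.2 *+ T] *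
      ((t ^+ (mu g * T))%:MP * (be g ^+ T)%:MP)); first by ring.
    by rewrite -hs'; ring.
  by rewrite -scalerA hT // scaler0.
exists (s2%:MP *: y); split.
- exact: gr_memZC.
- move=> g gs; exists N; have [_ _ hs] := hg g gs.
  rewrite scalerA /s2 (big_rem g) //=.
  have -> p : cmonom g ^+ N * (sg g ^+ N * p)%:MP =
      p%:MP * ((sg g * g.1) ^+ N *: 'X_[g.2 *+ N]).
    by rewrite cmonomX -!mul_mpolyC exprMn !mpolyCM; ring.
  rewrite -scalerA hs hb ?scaler0 //; right.
  exists g => //; split; first exact: lepm_refl.
  by exists (be g ^+ N); rewrite exprMn exprM.
- by rewrite scalerA mulrC -scalerA (mpolyCE_X t) e scalerA mpolyCM.
Qed.

End DependencyBound.

(** * Cohomology of the torsion elements killed by [q] *)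

Section CohomologyBound.
Variables (A : idomainType) (n : nat) (q : {pred A}) (hq : is_prime q).
Notation R := {mpoly A[n]}.
Variables (t s0 : A).
Hypotheses (tq : t \in q) (s0q : s0 \notin q)
  (hdiv : forall r, r \in q -> exists z, s0 * r = t * z)
  (ht0 : ~ is_zero_ideal q -> t != 0)
  (hfact : forall a, a != 0 -> exists s m b,
    [/\ s \notin q, b \notin q & s * a = t ^+ m * b]).

Lemma killed_uniformizer (V : lmodType R) (x : V) :
  t%:MP *: x = 0 -> killed q (s0%:MP *: x).
Proof.
move=> tx a aq; have [z hz] := hdiv aq.
rewrite scalerA -mpolyCM mulrC hz mulrC mpolyCM.
by rewrite -scalerA tx scaler0.
Qed.

Lemma dep_le1 (V : lmodType R) (Z B : V -> Prop) :
  (forall x0 x1, Z x0 -> Z x1 -> exists c0 c1,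
    (c0 \notin q \/ c1 \notin q) /\ B (c0%:MP *: x0 + c1%:MP *: x1)) ->
  dep_le q Z B 1.
Proof.
move=> h x hx; have [c0 [c1 [hc hB]]] := h _ _ (hx ord0) (hx (lift ord0 ord0)).
exists (fun i => if i == ord0 then c0 else c1); split.
  by case: hc => hc; [exists ord0 | exists (lift ord0 ord0)].
by rewrite !big_ord_recl big_ord0 addr0.
Qed.

(** The hypothesis says that [Z] vanishes modulo [B] after localization at [q], so dimension 0
    suffices. *)
Lemma dep_le_torsion (V : lmodType R) (Z B : V -> Prop) r :
  (forall x, Z x -> exists2 s, s \notin q & B (s%:MP *: x)) -> dep_le q Z B r.
Proof.
move=> h; apply: (dep_le_mono (leq0n r)) => x hx.
have [s sq hB] := h _ (hx ord0); exists (fun=> s); split; first by exists ord0.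
by rewrite big_ord1.
Qed.

Lemma dep_le_sub (V : lmodType R) (Z Z' B B' : V -> Prop) r :
  (forall x, Z' x -> Z x) -> (forall x, B x -> B' x) ->
  dep_le q Z B r -> dep_le q Z' B' r.
Proof.
move=> hZ hB h x hx; have [|c [hc hc']] := h x; first by move=> i; apply/hZ/hx.
by exists c; split=> //; apply: hB.
Qed.

Lemma mpoly_comp_rank1 (u : zdeg n) : exists m, forall p : R,
  p \in mpoly_comp A u -> p = p@_m *: 'X_[m].
Proof.
have [[m hm]|hno] := classic (exists m, mnm_zdeg m = u); last first.
  (* No monomial has degree [u], so the component is zero and any [m] will do. *)
  exists 0%MM => p /mpoly_compP h; apply/mpolyP => m'.
  by rewrite mcoeffZ !h ?mul0r //; apply/eqP => e; apply: hno; eexists; exact: e.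
exists m => p /mpoly_compP h; apply/mpolyP => m'; rewrite mcoeffZ mcoeffX.
have [->|/eqP ne] := eqVneq m m'; first by rewrite mulr1.
rewrite mulr0 h //; apply/eqP => e; apply: ne.
by apply: mnm_zdeg_inj; rewrite hm e.
Qed.

Variables (E : nat -> gradedModule A n)
  (eta : {linear mpoly_graded A n -> E 0%N})
  (delta : forall i, {linear E i -> E i.+1}).
Hypothesis res : is_injective_resolution eta delta.

Lemma delta_delta i x : delta i.+1 (delta i x) = 0.
Proof. by apply/(ir_exact res); exists x. Qed.

Lemma delta_eta x : delta 0%N (eta x) = 0.
Proof. by apply/(ir_exact0 res); exists x. Qed.

Lemma etaM (r p : R) : eta (r * p : R) = r *: eta p.
Proof. exact: linearZ. Qed.

(** By [homogeneous_part], applied to [g] and to multiplication by [r], the degree [u] component of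
    [x] has the same image and is killed by every homogeneous [r] that kills [x]. Torsion thus
    survives the passage to components. *)
Lemma homogeneous_preimage (M N : gradedModule A n) (g : {linear M -> N}) u y x :
  homogeneous_map g -> y \in gr_comp N u -> y = g x ->
  exists x', [/\ x' \in gr_comp M u, y = g x' &
    forall r v, (forall w z, z \in gr_comp M w -> r *: z \in gr_comp M (v + w)) ->
      r *: x = 0 -> r *: x' = 0].
Proof.
move=> hg hy ey; have [x' hx' hpart] := homogeneous_part u x.
exists x'; split=> // [|r v hr rx].
  rewrite ey in hy *; apply: (hpart N g 0); rewrite ?add0r // => v z hz.
  by rewrite add0r; apply: hg.
have [G hG] : exists G : {linear M -> M}, forall z, G z = r *: z.
  by apply: ex_linear => c z z'; rewrite scalerDr !scalerA mulrC.
rewrite -hG -(hpart M G v) ?hG ?rx // ?gr_mem0 // => w z hz.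
by rewrite hG; apply: hr.
Qed.

Lemma delta_exact_comp i u x : x \in gr_comp (E i.+1) u -> delta i.+1 x = 0 ->
  exists2 y, y \in gr_comp (E i) u & x = delta i y.
Proof.
move=> hx /(ir_exact res) [y e].
have hd := @ir_delta _ _ _ _ _ _ res i.
by have [y' [hy' e' _]] := homogeneous_preimage hd hx e; exists y'.
Qed.

Lemma eta_exact_comp u x : x \in gr_comp (E 0%N) u -> delta 0%N x = 0 ->
  exists2 p : R, p \in mpoly_comp A u & x = eta p.
Proof.
move=> hx /(ir_exact0 res) [y e].
by have [y' [hy' e' _]] := homogeneous_preimage (ir_eta res) hx e; exists y'.
Qed.

(** With [delta], these elements form the degree [u] part of the [fs]-torsion of the complex
    $E[q]$. *)
Definition tcochain fs i (u : zdeg n) (x : E i) :=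
  [/\ x \in gr_comp (E i) u, killed q x & ftor fs x].

Definition tcocycle fs i u (x : E i) := tcochain fs u x /\ delta i x = 0.

Definition tcoboundary fs i u : E i -> Prop :=
  match i with
  | 0 => fun x => x = 0
  | i'.+1 => fun x => exists2 y : E i', tcochain fs u y & x = delta i' y
  end.

Lemma tcochain0 fs i u : tcochain fs u (0 : E i).
Proof. by split; [exact: gr_mem0 | exact: killed0 | exact: ftor0]. Qed.

Lemma tcochainP fs i u a (x y : E i) :
  tcochain fs u x -> tcochain fs u y -> tcochain fs u (a%:MP *: x + y).
Proof.
move=> [h1 h2 h3] [h1' h2' h3']; split; [|exact: killedP|exact: ftorP].
by apply: gr_memD => //; apply: gr_memZC.
Qed.

Lemma tcochainZ fs i u a (x : E i) : tcochain fs u x -> tcochain fs u (a%:MP *: x).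
Proof.
by move=> hx; rewrite -[_ *: _]addr0; apply: tcochainP => //; apply: tcochain0.
Qed.

Lemma tcochain_sum fs i u (T : finType) (c : T -> A) (x : T -> E i) :
  (forall k, tcochain fs u (x k)) -> tcochain fs u (\sum_k (c k)%:MP *: x k).
Proof.
move=> hx; elim/big_ind: _ => //; first exact: tcochain0.
- by move=> y z hy hz; rewrite -[y]scale1r -mpolyC1; apply: tcochainP.
- by move=> k _; apply: tcochainZ.
Qed.

Lemma tcochain_delta fs i u (x : E i) : tcochain fs u x -> tcochain fs u (delta i x).
Proof.
move=> [h1 h2 h3]; split; first exact: (ir_delta res).
  by move=> a aq; rewrite -linearZ /= h2 // linear0.
by move=> f /h3 [N hN]; exists N; rewrite -linearZ /= hN linear0.
Qed.

Lemma tcochain_cmonom fs i u f N (x : E i) : tcochain fs u x ->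
  tcochain fs (mnm_zdeg (f.2 *+ N)%MM + u) (cmonom f ^+ N *: x).
Proof.
move=> [h1 h2 h3]; split; last exact: ftorZ.
  by rewrite cmonomX; apply: gr_memZX.
by rewrite -[_ *: _]addr0; apply: killedP => //; apply: killed0.
Qed.

Lemma tcocycleP fs i u a (x y : E i) :
  tcocycle fs u x -> tcocycle fs u y -> tcocycle fs u (a%:MP *: x + y).
Proof.
move=> [h1 h2] [h1' h2']; split; first exact: tcochainP.
by rewrite linearP /= h2 h2' scaler0 addr0.
Qed.

(** For $q=0$ being killed is no condition, so the complex is $E_u$, a resolution of $R_u$, which is
    free of rank at most one. Two elements of $R_u$ are related by cross-multiplying
    coefficients. *)
Lemma base_bound_zero i u : is_zero_ideal q ->
  dep_le q (@tcocycle [::] i u) (@tcoboundary [::] i u) 1.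
Proof.
move=> q0; have kz (V : lmodType R) (x : V) : killed q x.
  by move=> a /q0 ->; rewrite mpolyC0 scale0r.
case: i => [|i]; last first.
  apply: dep_le_torsion => x [[hx _ _] dx]; have [y hy e] := delta_exact_comp hx dx.
  by exists 1; [exact: notin_prime1 | exists y; rewrite ?mpolyC1 ?scale1r].
have [m hm] := mpoly_comp_rank1 u.
apply: dep_le1 => x0 x1 [[h0 _ _] d0] [[h1 _ _] d1] /=.
have [p0 /hm e0 ->] := eta_exact_comp h0 d0.
have [p1 /hm e1 ->] := eta_exact_comp h1 d1.
have [z|nz] := eqVneq p1@_m 0.
  exists 0, 1; split; first by right; apply: notin_prime1.
  by rewrite e1 z mpolyC0 scale0r scale0r linear0 scaler0 addr0.
exists p1@_m, (- p0@_m); split; first by left; apply/negP => /q0/eqP; rewrite (negPf nz).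
rewrite -!etaM -linearD /= {1}e0 {2}e1 -!mul_mpolyC mpolyCN.
by rewrite (_ : _ + _ = 0) ?linear0 //; ring.
Qed.

(** For $q\neq 0$, multiplication by [t] is injective on [R] and, up to factors outside [q],
    surjective on [E]. Locally at [q] the cohomology is therefore $R_u/tR_u$ in degree 1 and zero
    elsewhere: a class $\delta y$ corresponds to [p] with $ty=\eta(p)$. *)
Lemma base_bound i u : dep_le q (@tcocycle [::] i u) (@tcoboundary [::] i u) 1.
Proof.
have [/base_bound_zero //|/ht0 t0] := classic (is_zero_ideal q).
have eta_t (p : R) : t%:MP *: eta p = 0 -> p = 0.
  rewrite -etaM -[X in _ = X](linear0 eta) => /(ir_mono res) e.
  apply/eqP; move/eqP: e; rewrite mulf_eq0 mpolyC_eq0.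
  by rewrite (negPf t0).
have ftor_nil (V : lmodType R) (x : V) : ftor [::] x by [].
have kt (V : lmodType R) (x : V) : killed q x -> t%:MP *: x = 0 by apply.
case: i => [|[|i]].
- apply: dep_le_torsion => x [[hx kx _] dx]; exists 1; first exact: notin_prime1.
  have [p _ e] := eta_exact_comp hx dx; rewrite e in kx *.
  by rewrite (eta_t _ (kt _ _ kx)) linear0 scaler0.
- have [m hm] := mpoly_comp_rank1 u.
  have hpre x : tcocycle [::] u x -> exists (y : E 0%N) (p : R),
      [/\ y \in gr_comp (E 0%N) u, x = delta 0%N y,
        t%:MP *: y = eta p, p = p@_m *: 'X_[m] & p \in mpoly_comp A u].
    move=> [[hx kx _] dx]; have [y hy e] := delta_exact_comp hx dx.
    have [||p hp e'] := @eta_exact_comp u (t%:MP *: y).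
    + exact: gr_memZC.
    + by rewrite linearZ /= -e kt.
    by exists y, p; split=> //; apply: hm.
  have fin (w : E 0%N) x : w \in gr_comp (E 0%N) u -> t%:MP *: w = 0 ->
      delta 0%N w = x -> tcoboundary [::] u (s0%:MP *: x).
    move=> hw tw <-; exists (s0%:MP *: w); last by rewrite linearZ.
    by split=> //; [exact: gr_memZC | exact: killed_uniformizer].
  apply: dep_le1 => x0 x1 /hpre [y0 [p0 [h0 -> t0' e0 _]]]
    /hpre [y1 [p1 [h1 -> t1 e1 hp1]]].
  (* If the coefficient lies in [q], then $s_0p_1$ is divisible by [t], and correcting $s_0y_1$ by
     an element of the image of [eta] makes it killed by [t]. Otherwise cross-multiplication gives
     the relation. *)
  have [b1q|b1q] := boolP (p1@_m \in q).
    have [z hz] := hdiv b1q; exists 0, (s0 * s0).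
    split; first by right; apply: notin_primeM.
    rewrite mpolyC0 scale0r add0r mpolyCM -scalerA.
    apply: (fin (s0%:MP *: y1 - eta (z *: 'X_[m]))).
    + apply: gr_memB; first exact: gr_memZC.
      (* The monomial of index [m] is known to have degree [u] only if [p1@_m] is nonzero; otherwise
         $z=0$. *)
      apply: (ir_eta res); have [b0|bn] := eqVneq p1@_m 0.
        move/eqP: hz; rewrite b0 mulr0 eq_sym mulf_eq0 (negPf t0) => /eqP ->.
        by rewrite scale0r gr_mem0.
      suff <- : mnm_zdeg m = u by apply: monomial_comp.
      by apply/eqP; apply: contraR bn => /(mpoly_compP _ _ hp1)/eqP.
    + rewrite scalerBr scalerA mulrC -scalerA t1 -!etaM -linearB /=.
      rewrite e1 -!mul_mpolyC.
      rewrite (_ : _ - _ = 0) ?linear0 //.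
      by rewrite !mulrA -!mpolyCM hz subrr.
    + by rewrite linearB linearZ /= delta_eta subr0.
  exists (s0 * p1@_m), (s0 * - p0@_m); split; first by left; apply: notin_primeM.
  rewrite !mpolyCM -!scalerA -scalerDr.
  apply: (fin ((p1@_m)%:MP *: y0 + (- p0@_m)%:MP *: y1)).
  + by apply: gr_memD; apply: gr_memZC.
  + rewrite scalerDr !scalerA ![t%:MP * _]mulrC -!scalerA t0' t1 -!etaM -linearD /=.
    rewrite {1}e0 {2}e1 -!mul_mpolyC mpolyCN.
    by rewrite (_ : _ + _ = 0) ?linear0 //; ring.
  + by rewrite linearD !linearZ.
(* Here $x=\delta y$ and $ty=\delta z$. Dividing [z] by [t], say $tz'=sz$, makes $sy-\delta z'$
   killed by [t], with boundary $sx$. *)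
- apply: dep_le_torsion => x [[hx kx _] dx].
  have [y hy e] := delta_exact_comp hx dx.
  have [||z hz e'] := @delta_exact_comp i u (t%:MP *: y).
  + exact: gr_memZC.
  + by rewrite linearZ /= -e kt.
  have [//|s sq [z' [hz' _ tz']]] :=
    uniformizer_division hq (@ir_inj _ _ _ _ _ _ res i) t0 hfact _ hz (ftor_nil _ z).
  exists (s0 * s); first exact: notin_primeM.
  exists (s0%:MP *: (s%:MP *: y - delta i z')).
    split=> //.
      apply: gr_memZC; apply: gr_memB; first exact: gr_memZC.
      exact: (ir_delta res).
    apply: killed_uniformizer; rewrite scalerBr -[_ *: delta i z']linearZ /=.
    rewrite tz' [delta i _]linearZ /= -e'.
    by rewrite !scalerA mulrC subrr.
  by rewrite linearZ linearB linearZ /= delta_delta subr0 -e scalerA mpolyCM.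
Qed.

Lemma tcohomology_bound fs i u :
  dep_le q (@tcocycle fs i u) (@tcoboundary fs i u) (2 ^ size fs).
Proof.
elim: fs i u => [|f fs ih] i u; first exact: base_bound.
have cons_sub j v (x : E j) : tcochain (f :: fs) v x -> tcochain fs v x.
  by case=> h1 h2 h3; split=> // g gs; apply: h3; rewrite inE gs orbT.
have to_cons j v N (x : E j) : tcochain fs v x -> cmonom f ^+ N *: x = 0 ->
    tcochain (f :: fs) v x.
  move=> [h1 h2 h3] h; split=> // g; rewrite inE => /predU1P [->|]; last exact: h3.
  by exists N.
(* A coefficient in [q] makes [f] annihilate everything killed by [q], so adding [f] does not change
   the complex. *)
have [fq|fq] := boolP (f.1 \in q).
  have cons_eq j v (x : E j) : tcochain fs v x -> tcochain (f :: fs) v x.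
    move=> hx; apply: (to_cons _ _ 1%N) => //; case: hx => _ kx _.
    by rewrite expr1 /cmonom -mul_mpolyC mulrC -scalerA kx ?scaler0.
  apply: (dep_le_mono (r := 2 ^ size fs)); first by rewrite leq_exp2l.
  apply: dep_le_sub (ih i u) => [x [hx dx]|]; first by split=> //; apply: cons_sub.
  by case: i => //= i x [y hy ->]; exists y => //; apply: cons_eq.
rewrite expnS mul2n -addnn.
(* One half of the bound is for the image in the cohomology for [fs], the other for the classes that
   die there. *)
apply: (@dep_le_add _ _ _ hq _ _ (@tcoboundary fs i u)) => //.
- by move=> x [[]].
- by move=> a x y; apply: tcocycleP.
- by split; [exact: tcochain0 | rewrite linear0].
- by apply: dep_le_sub (ih i u) => // x [hx dx]; split=> //; apply: cons_sub.
case: i => [|i] x hx.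
  exists (fun=> 1); split; first by exists ord0; apply: notin_prime1.
  by rewrite /= big1 // => k _; have [_ ->] := hx k; rewrite scaler0.
have hpre k : exists y : E i, tcochain fs u y /\ x k = delta i y.
  by have [_ [y]] := hx k; exists y.
have {hpre} [y hy] := functional_choice _ hpre.
(* A power of [f] that kills every [x k] turns the primitives [y k] into cocycles of degree [v],
   where the induction hypothesis gives a relation. *)
have [N hN] : exists N, forall k, cmonom f ^+ N *: x k = 0.
  apply: all_bounded_nat => [k m m' /subnK <- h|k].
    by rewrite exprD -scalerA h scaler0.
  by have [[[_ _ h] _] _] := hx k; apply: h; rewrite inE eqxx.
pose v := mnm_zdeg (f.2 *+ N)%MM + u.
have hz k : tcocycle fs v (cmonom f ^+ N *: y k).
  split; first by apply: tcochain_cmonom; case: (hy k).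
  by rewrite linearZ /= -(hy k).2.
have [c [[k0 ck0] hB]] := ih i v _ hz.
have ysum : tcochain fs u (\sum_k (c k)%:MP *: y k).
  by apply: tcochain_sum => k; case: (hy k).
have dsum : delta i (\sum_k (c k)%:MP *: y k) = \sum_k (c k)%:MP *: x k.
  by rewrite raddf_sum; apply: eq_bigr => k _; rewrite /= linearZ /= (hy k).2.
have fsum : \sum_k (c k)%:MP *: (cmonom f ^+ N *: y k) =
    cmonom f ^+ N *: \sum_k (c k)%:MP *: y k.
  by rewrite scaler_sumr; apply: eq_bigr => k _; rewrite !scalerA mulrC.
rewrite fsum {fsum hz hN} in hB.
(* When the primitives lie in [E 0], the relation says that $f^N$ kills $\sum_kc_ky_k$, which is
   then a cochain for [f :: fs]. *)
case: i x hx y hy ysum dsum hB => [|i] x hx y hy ysum dsum /= hB.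
  exists c; split; first by exists k0.
  by rewrite -dsum; exists (\sum_k (c k)%:MP *: y k) => //; apply: to_cons hB.
(* Now $f^N\sum_kc_ky_k=\delta w$. With $f^Nw'=sw$, the element $s\sum_kc_ky_k-\delta w'$ is killed
   by $f^N$ and has boundary $s\sum_kc_kx_k$. *)
case: hB => w [hw kw tw] ew.
have fNq : (f.1 ^+ N, (f.2 *+ N)%MM).1 \notin q by apply: notin_primeX.
have [s sq [w' [hw' kw' tw' ew']]] :=
  killed_division hq (@ir_inj _ _ _ _ _ _ res i) fNq hw kw tw.
exists (fun k => s * c k); split; first by exists k0; apply: notin_primeM.
exists (s%:MP *: (\sum_k (c k)%:MP *: y k) - delta i w').
  apply: (to_cons _ _ N).
    rewrite -scaleN1r addrC (_ : -1 = (-1)%:MP); last by rewrite mpolyCN mpolyC1.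
    apply: tcochainP; last exact: tcochainZ.
    exact: tcochain_delta.
  rewrite scalerBr -[_ *: delta i w']linearZ /= cmonomX ew' [delta i _]linearZ /= -ew.
  by rewrite -cmonomX !scalerA mulrC subrr.
rewrite linearB linearZ /= delta_delta subr0 dsum scaler_sumr.
by apply: eq_bigr => k _; rewrite scalerA mpolyCM.
Qed.

End CohomologyBound.

(** * Ext over a discrete valuation ring *)

Section ExtOverDvr.
Variables (S : comNzRingType) (k : fieldType) (pi : {rmorphism S -> k}) (tau : S).
(* S is a field (tau = 0) or a discrete valuation ring with uniformizer tau. *)
Hypotheses (pi_surj : forall z, exists y, pi y = z)
  (pi_ker : forall y, pi y = 0 -> exists z, y = tau * z)
  (pi_tau : pi tau = 0)
  (pi_unit : forall y, pi y != 0 -> exists y', y' * y = 1)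
  (tau_reg : tau = 0 \/ forall y, tau * y = 0 -> y = 0).
Variables (P : nat -> lmodType S) (d : forall j, {linear P j.+1 -> P j})
  (eps : {linear P 0%N -> k | pi \; *%R}).
Hypothesis res : is_projective_resolution d eps.
Variable N : lmodType S.

Lemma ext_coboundaryP j a (f g h : P j -> N) :
  ext_coboundary d f -> ext_coboundary d g -> (forall x, h x = a *: f x + g x) ->
  ext_coboundary d h.
Proof.
case: j f g h => [|j] f g h /= => [hf hg e x|[F hF] [G hG] e].
  by rewrite e hf hg scaler0 addr0.
have [H hH] : exists H : {linear P j -> N}, forall x, H x = a *: F x + G x.
  apply: ex_linear => c x y; rewrite [F _]linearP [G _]linearP /=.
  by rewrite !scalerDr !scalerA [a * c]mulrC addrACA.
by exists H => x; rewrite e hH hF hG.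
Qed.

(** A maximal independent family of cocycles exists by the first hypothesis, and it spans: in a
    relation with a further cocycle, the coefficient of that cocycle is a unit, since a multiple of
    [tau] would drop out by the second hypothesis. *)
Lemma ext_dim_of_dependent j B :
  (forall f : 'I_B.+1 -> {linear P j -> N}, (forall i, ext_cocycle d (f i)) ->
    exists c : 'I_B.+1 -> S, (exists i, pi (c i) != 0) /\
      ext_coboundary d (fun x => \sum_i c i *: f i x)) ->
  (forall f : {linear P j -> N}, ext_cocycle d f ->
    ext_coboundary d (fun x => tau *: f x)) ->
  exists r, ext_dim pi d N j r.
Proof.
move=> hdep htau.
have ext0 (f g : P j -> N) : (forall x, f x = g x) -> ext_coboundary d f ->
    ext_coboundary d g.
  case: j f g {hdep htau} => [|j] f g e /= => [hf x|[F hF]]; first by rewrite -e.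
  by exists F => x; rewrite -e.
pose indep r := exists z : 'I_r -> {linear P j -> N},
  (forall i, ext_cocycle d (z i)) /\
  forall c : 'I_r -> S, ext_coboundary d (fun x => \sum_i c i *: z i x) ->
    forall i, pi (c i) = 0.
have [r [z [hz hind]] hmax] : exists2 r, indep r & ~ indep r.+1.
  apply: NNPP => hno; have hall r : indep r.
    elim: r => [|r ih]; last by apply: NNPP => h; apply: hno; exists r.
    by exists (fun i : 'I_0 => False_rect _ (notF (ltn_ord i))); split=> [|c _] [].
  have [z [hz hind]] := hall B.+1; have [c [[i ci] hc]] := hdep z hz.
  by move: ci; rewrite hind // eqxx.
exists r, z; split=> // f hf.
pose z' i := if unlift ord0 i is Some i' then z i' else f.
have sum_z' (c : 'I_r.+1 -> S) x : \sum_i c i *: z' i x =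
    c ord0 *: f x + \sum_i c (lift ord0 i) *: z i x.
  rewrite big_ord_recl /z' unlift_none; congr (_ + _).
  by apply: eq_bigr => i _; rewrite liftK.
have [c [hc [i0 ci0]]] : exists c : 'I_r.+1 -> S,
    ext_coboundary d (fun x => \sum_i c i *: z' i x) /\ exists i, pi (c i) != 0.
  apply: NNPP => hno; apply: hmax; exists z'; split.
    by move=> i; rewrite /z'; case: unliftP.
  move=> c hc i; apply/eqP/negPn/negP => ci; apply: hno.
  by exists c; split=> //; exists i.
have [c0|c0] := eqVneq (pi (c ord0)) 0.
  case/eqP: ci0; case: (unliftP ord0 i0) => [i' ->|-> //].
  apply: (hind (fun i => c (lift ord0 i))); have [w hw] := pi_ker c0.
  apply: (ext_coboundaryP (a := - w) (htau f hf) hc) => x.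
  by rewrite sum_z' hw addrA scalerA mulNr scaleNr mulrC addNr add0r.
have [w hw] := pi_unit c0.
exists (fun i => - (w * c (lift ord0 i))).
have hc0 : ext_coboundary d (fun x => 0 *: f x).
  have := ext_coboundaryP (a := -1) (h := fun x => 0 *: f x) hc hc; apply => x.
  by rewrite scale0r scaleN1r addNr.
apply: (ext_coboundaryP (a := w) hc hc0) => x.
rewrite sum_z' scale0r addr0 scalerDr scalerA hw scale1r scaler_sumr.
rewrite -sumrN; congr (_ + _); apply: eq_bigr => i _.
by rewrite scaleNr opprK scalerA.
Qed.

Lemma linear_sum (U V : lmodType S) (r : nat) (c : 'I_r -> S)
    (f : 'I_r -> {linear U -> V}) :
  exists g : {linear U -> V}, forall x, g x = \sum_i c i *: f i x.
Proof.
apply: ex_linear => a x y; rewrite scaler_sumr -big_split /=.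
by apply: eq_bigr => i _; rewrite linearP scalerDr !scalerA mulrC.
Qed.

Lemma d_d j x : d j (d j.+1 x) = 0.
Proof. by apply/(pr_exact res); exists x. Qed.

Lemma eps_d x : eps (d 0%N x) = 0.
Proof. by apply/(pr_exact0 res); exists x. Qed.

Lemma eps_lift x0 x : eps x0 = 1 -> exists c p, x = c *: x0 + d 0%N p.
Proof.
move=> e0; have [c hc] := pi_surj (eps x).
have [|p hp] := (pr_exact0 res (x - c *: x0)).1.
  by rewrite linearB linearZ /= e0 mulr1 hc subrr.
by exists c, p; rewrite -hp addrC subrK.
Qed.

Lemma ex_tau_lift x0 : eps x0 = 1 -> exists e, tau *: x0 = d 0%N e.
Proof. by move=> e0; apply/(pr_exact0 res); rewrite linearZ /= e0 pi_tau mul0r. Qed.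

Section Unit.
Variables (x0 : P 0%N) (e : P 1%N).
Hypotheses (e0 : eps x0 = 1) (de : tau *: x0 = d 0%N e).

Lemma ext0_zero (f : {linear P 0%N -> N}) a :
  ext_cocycle d f -> a *: f x0 = 0 -> forall x, a *: f x = 0.
Proof.
move=> hf fa x; have [c [p ->]] := eps_lift x e0.
by rewrite linearD linearZ /= hf addr0 scalerA mulrC -scalerA fa scaler0.
Qed.

(** The map [g] is to send [x0] to [y] and [d 0 p] to [f p]. This is consistent because every
    relation between [x0] and boundaries is a multiple of $\tau x_0=d(e)$ modulo cycles, on which
    [f] vanishes. *)
Lemma ext1_coboundary (f : {linear P 1%N -> N}) y :
  ext_cocycle d f -> f e = tau *: y -> ext_coboundary d f.
Proof.
move=> hf fe; have [cp hcp] : exists cp : P 0%N -> S * P 1%N,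
    forall x, x = (cp x).1 *: x0 + d 0%N (cp x).2.
  apply: (functional_choice (fun x (cp : S * P 1%N) => x = cp.1 *: x0 + d 0%N cp.2)).
  by move=> x; have [c [p hx]] := eps_lift x e0; exists (c, p).
have uniq0 c p : c *: x0 + d 0%N p = 0 -> c *: y + f p = 0.
  move=> h; have [|z hz] := @pi_ker c.
    by move/(congr1 eps): h; rewrite linear0 linearD linearZ /= eps_d addr0 e0 mulr1.
  have [|p2 hp2] := (pr_exact res (j := 0) (z *: e + p)).1.
    by rewrite linearD linearZ /= -de -[RHS]h hz scalerA mulrC.
  have := hf p2; rewrite -hp2 linearD linearZ /= fe hz scalerA mulrC //.
have uniq c p c' p' : c *: x0 + d 0%N p = c' *: x0 + d 0%N p' ->
    c *: y + f p = c' *: y + f p'.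
  move=> h; apply/eqP; rewrite -subr_eq0; apply/eqP.
  have -> : c *: y + f p - (c' *: y + f p') = (c - c') *: y + f (p - p').
    by rewrite linearB scalerBl opprD addrACA.
  by apply: uniq0; rewrite linearB scalerBl addrACA -opprD h subrr.
have [g hg] : exists g : {linear P 0%N -> N}, forall x,
    g x = (cp x).1 *: y + f (cp x).2.
  apply: ex_linear => a x x'.
  rewrite (@uniq _ _ (a * (cp x).1 + (cp x').1) (a *: (cp x).2 + (cp x').2)).
    by rewrite linearP scalerDl scalerDr scalerA addrACA.
  by rewrite -hcp linearP scalerDl addrACA -scalerA -scalerDr -!hcp.
have hx x : (cp (d 0%N x)).1 *: x0 + d 0%N (cp (d 0%N x)).2 = 0 *: x0 + d 0%N x.
  by rewrite -hcp scale0r add0r.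
by exists g => x; rewrite hg (uniq _ _ _ _ (hx x)) scale0r add0r.
Qed.

(* A projection of P_1 onto its cycles: since k has a resolution of length one
   over S, the module of cycles is a direct summand. *)
Lemma cycle_projection1 : exists p : {linear P 1%N -> P 1%N},
  (forall x, d 0%N (p x) = 0) /\ forall x, p (d 1%N x) = d 1%N x.
Proof.
have [g hg] : exists g : {linear (P 1%N * S^o)%type -> P 0%N},
    forall x, g x = d 0%N x.1 + (x.2 : S) *: x0.
  apply: ex_linear => a x y /=.
  by rewrite linearP scalerDl scalerDr addrACA -scalerA.
have [idP hid] : exists f : {linear P 0%N -> P 0%N}, forall x, f x = x.
  by apply: ex_linear.
have [|h hh] := pr_proj res (j := 0%N) (g := g) idP.
  by move=> x; have [c [p ->]] := eps_lift x e0; exists (p, c); rewrite hg addrC.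
(* The map [h] is a section of $P_1\oplus S\to P_0$. On boundaries its second component is divisible
   by [tau], and [kap] is a linear choice of the quotient. *)
pose h2 x : S := (h (d 0%N x)).2.
have h2ker x : exists z, h2 x = tau * z.
  apply: pi_ker; have := hh (d 0%N x); rewrite hid hg => /(congr1 eps).
  by rewrite linearD linearZ /= !eps_d e0 add0r mulr1 => ->.
have [kap hkap kap0] : exists2 kap : {linear P 1%N -> S^o},
    forall x, tau * kap x = h2 x & forall x, h2 x = 0 -> kap x = 0.
  case: tau_reg => [t0|treg].
    have [z hz] : exists z : {linear P 1%N -> S^o}, forall x, z x = 0.
      by apply: ex_linear => a x y; rewrite scaler0 addr0.
    by exists z => x; rewrite hz // mulr0; have [w ->] := h2ker x; rewrite t0 mul0r.
  have [K hK] := functional_choice _ h2ker.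
  have [kap hkap] : exists kap : {linear P 1%N -> S^o}, forall x, kap x = K x.
    apply: ex_linear => a x y; apply/eqP; rewrite -subr_eq0; apply/eqP/treg.
    rewrite /GRing.scale /= mulrBr mulrDr mulrCA -!hK /h2 !linearP /=.
    by rewrite /GRing.scale /= subrr.
  exists kap => x; rewrite hkap -?hK // => h0.
  by apply: treg; rewrite -hK.
have [p hp] : exists p : {linear P 1%N -> P 1%N},
    forall x, p x = x - (h (d 0%N x)).1 - (kap x : S) *: e.
  apply: ex_linear => a x y; rewrite !linearP /= scalerDl -scalerA.
  by rewrite !opprD -!scalerN (addrACA (a *: x)) [LHS]addrACA -!scalerDr.
exists p; split=> x; rewrite hp.
  rewrite !linearB linearZ /= -de scalerA mulrC hkap.
  by have := hh (d 0%N x); rewrite hid hg => {1}<-; rewrite addrAC addrK subrr.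
have h0 : h (d 0%N (d 1%N x)) = 0 by rewrite d_d linear0.
by rewrite h0 kap0 /h2 ?h0 // scale0r !subr0.
Qed.

End Unit.

(** Given a projection [p] onto the cycles of $P_{j+1}$, the map $(y,x)\mapsto dy+x-px$ onto
    $P_{j+1}$ has a section [h]. Then $p=d\circ h_1$, and $1-h_1\circ d$ projects $P_{j+2}$ onto its
    cycles. *)
Lemma cycle_projection j : exists p : {linear P j.+1 -> P j.+1},
  (forall x, d j (p x) = 0) /\ forall x, p (d j.+1 x) = d j.+1 x.
Proof.
elim: j => [|j [p [dp pd]]].
  have [z hz] := pr_surj res 1; have [e he] := ex_tau_lift hz.
  exact: cycle_projection1 hz he.
have [g hg] : exists g : {linear (P j.+2 * P j.+1)%type -> P j.+1},
    forall x, g x = d j.+1 x.1 + (x.2 - p x.2).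
  apply: ex_linear => a x y /=.
  rewrite [d _ _]linearP [p _]linearP /= opprD -scalerN.
  by rewrite [X in _ + X = _]addrACA [LHS]addrACA -!scalerDr.
have [idP hid] : exists f : {linear P j.+1 -> P j.+1}, forall x, f x = x.
  by apply: ex_linear.
have pimg x : exists y, p x = d j.+1 y by apply/(pr_exact res).
have [|h hh] := pr_proj res (j := j.+1) (g := g) idP.
  by move=> x; have [y hy] := pimg x; exists (y, x); rewrite hg /= -hy addrC subrK.
have hp x : p x = d j.+1 (h x).1.
  have := congr1 p (hh x); rewrite hid hg linearD pd linearB /= => <-.
  by have [y hy] := pimg (h x).2; rewrite hy pd subrr addr0.
have [p' hp'] : exists p' : {linear P j.+2 -> P j.+2},
    forall x, p' x = x - (h (d j.+1 x)).1.
  by apply: ex_linear => a x y; rewrite !linearP /= addrACA -scalerDr.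
exists p'; split=> x; rewrite hp'.
  by rewrite linearB /= -hp pd subrr.
by rewrite d_d linear0 subr0.
Qed.

(** A cocycle factors through [d] on the module of boundaries, and the projection onto cycles
    extends it from there to $P_{j+1}$. *)
Lemma ext_vanish j (f : {linear P j.+2 -> N}) : ext_cocycle d f -> ext_coboundary d f.
Proof.
move=> hf; have [p [dp pd]] := cycle_projection j.
have pimg x : exists y, p x = d j.+1 y by apply/(pr_exact res).
have [l hl] := functional_choice _ pimg.
have uniq y y' : d j.+1 y = d j.+1 y' -> f y = f y'.
  move=> h; have [|z hz] := (pr_exact res (y - y')).1.
    by rewrite linearB h subrr.
  by apply/eqP; rewrite -subr_eq0 -linearB hz hf.
have [g hg] : exists g : {linear P j.+1 -> N}, forall x, g x = f (l x).
  apply: ex_linear => a x y; rewrite -linearP; apply: uniq.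
  by rewrite -hl !linearP /= !hl.
by exists g => x; rewrite hg; apply: uniq; rewrite -hl pd.
Qed.

Hypothesis tors_bound : exists B, forall y : 'I_B.+1 -> N,
  (forall i, tau *: y i = 0) -> exists c : 'I_B.+1 -> S,
  (exists i, pi (c i) != 0) /\ \sum_i c i *: y i = 0.
Hypothesis quot_bound : exists B, forall y : 'I_B.+1 -> N,
  exists c : 'I_B.+1 -> S,
  (exists i, pi (c i) != 0) /\ exists w, \sum_i c i *: y i = tau *: w.

(** Evaluation at [x0] detects $\operatorname{Ext}^0$ in the [tau]-torsion of [N], and evaluation at
    [e] detects $\operatorname{Ext}^1$ in $N/\tau N$. *)
Lemma ext_dim_finite j : exists r, ext_dim pi d N j r.
Proof.
have [x0 e0] := pr_surj res 1; have [e he] := ex_tau_lift e0.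
case: j => [|[|j]].
- have [B hB] := tors_bound; apply: (ext_dim_of_dependent (B := B)).
    move=> f hf; have [|c [hc hc0]] := hB (fun i => f i x0).
      by move=> i; rewrite -linearZ /= he hf.
    have [F hF] := linear_sum c f.
    exists c; split=> // x; rewrite -hF -[F x]scale1r.
    apply: (ext0_zero e0); last by rewrite hF hc0 scaler0.
    by move=> y; rewrite hF big1 // => i _; rewrite hf scaler0.
  move=> f hf x; apply: (ext0_zero e0 hf).
  by rewrite -linearZ /= he hf.
- have [B hB] := quot_bound; apply: (ext_dim_of_dependent (B := B)).
    move=> f hf; have [c [hc [w hw]]] := hB (fun i => f i e).
    have [F hF] := linear_sum c f; exists c; split=> //.
    have [||g hg] := @ext1_coboundary x0 e e0 he F w.
    + by move=> y; rewrite hF big1 // => i _; rewrite hf scaler0.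
    + by rewrite hF.
    by exists g => x; rewrite -hF.
  move=> f hf.
  have [F hF] : exists F : {linear P 1%N -> N}, forall x, F x = tau *: f x.
    by apply: ex_linear => a x y; rewrite [f _]linearP scalerDr !scalerA mulrC.
  have [||g hg] := @ext1_coboundary x0 e e0 he F (f e).
  + by move=> y; rewrite hF hf scaler0.
  + by rewrite hF.
  by exists g => x; rewrite -hF.
- apply: (ext_dim_of_dependent (B := 0%N)) => [f hf|f hf].
    exists (fun=> 1); split; first by exists ord0; rewrite rmorph1 oner_neq0.
    have [g hg] := ext_vanish (hf ord0).
    by exists g => x; rewrite big_ord1 scale1r.
  have [g hg] := ext_vanish hf.
  have [G hG] : exists G : {linear P j.+1 -> N}, forall x, G x = tau *: g x.
    by apply: ex_linear => a x y; rewrite [g _]linearP scalerDr !scalerA mulrC.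
  by exists G => x; rewrite hG -hg.
Qed.

End ExtOverDvr.

(** * Components of local cohomology *)

Section GeneratedTorsion.
Variables (A : idomainType) (n c : nat) (a : 'I_c -> A) (U : 'I_c -> 'X_{1..n}).
Notation R := {mpoly A[n]}.
Let g (l : 'I_c) : R := a l *: 'X_[U l].

Definition gen_seq := [seq (a l, U l) | l <- enum 'I_c].

Lemma ftor_gen_seq (V : lmodType R) (x : V) :
  ftor gen_seq x <-> forall l, exists N, g l ^+ N *: x = 0.
Proof.
split=> [h l|h f /mapP [l _ ->]]; last exact: h.
by apply: (h (a l, U l)); apply/mapP; exists l; rewrite ?mem_enum.
Qed.

(** This is the pigeonhole principle: expanding one factor moves some [g l] onto [x], which lowers
    [N l] by one for the remaining product. *)
Lemma prod_gen_ideal_kills (V : lmodType R) s (N : 'I_c -> nat) (x : V) :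
  (\sum_l N l <= s)%N -> (forall l, g l ^+ N l *: x = 0) ->
  forall f : 'I_s.+1 -> R, (forall i, gen_ideal g (f i)) -> (\prod_i f i) *: x = 0.
Proof.
elim: s N x => [|s ih] N x hN hx f hf; rewrite big_ord_recl;
    have [p ->] := hf ord0; rewrite mulr_suml scaler_suml big1 // => l _.
  have N0 : N l = 0%N.
    by apply/eqP; rewrite -leqn0; apply: leq_trans hN; rewrite (bigD1 l) ?leq_addr.
  by have := hx l; rewrite N0 scale1r => ->; rewrite scaler0.
case Nl: (N l) => [|m].
  by have := hx l; rewrite Nl scale1r => ->; rewrite scaler0.
rewrite -mulrA [g l * _]mulrC mulrA -scalerA -scalerA.
rewrite (ih (fun l' => if l' == l then m else N l')) ?scaler0 //.
- rewrite (bigD1 l) //= eqxx.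
  move: hN; rewrite (bigD1 l) //= Nl addSn ltnS; apply: leq_trans.
  by rewrite leq_add2l; apply: leq_sum => l' /negPf ->.
- move=> l'; case: eqP => [->|_]; first by rewrite scalerA -exprSr -Nl hx.
  by rewrite scalerA mulrC -scalerA hx scaler0.
Qed.

Lemma torsion_ftor (M : gradedModule A n) (x : M) :
  torsion (gen_ideal g) x <-> ftor gen_seq x.
Proof.
rewrite ftor_gen_seq; split=> [[t ht] l|h].
  exists t; have := ht (fun=> g l); rewrite prodr_const card_ord; apply=> _.
  exact: gen_ideal_gen.
have [N hN] := functional_choice _ h.
by exists (\sum_l N l).+1; apply: prod_gen_ideal_kills.
Qed.

End GeneratedTorsion.

Section ComponentBound.
Variables (A : idomainType) (n : nat) (q : {pred A}) (hq : is_prime q).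
Notation R := {mpoly A[n]}.
Variables (t s0 : A).
Hypotheses (tq : t \in q) (s0q : s0 \notin q)
  (hdiv : forall r, r \in q -> exists z, s0 * r = t * z)
  (ht0 : ~ is_zero_ideal q -> t != 0)
  (hfact : forall a, a != 0 -> exists s m b,
    [/\ s \notin q, b \notin q & s * a = t ^+ m * b]).

(** The factors [s] outside [q] are absorbed into the coefficients of a relation among the
    approximations. *)
Lemma dep_le_approx (V : lmodType R) (Z Z' B : V -> Prop) r :
  (forall a x y, B x -> B y -> B (a%:MP *: x + y)) -> B 0 ->
  (forall x, Z x -> exists2 s, s \notin q & exists2 x', Z' x' & B (s%:MP *: x - x')) ->
  dep_le q Z' B r -> dep_le q Z B r.
Proof.
move=> Blin B0 happ h x hx.
have [sx hsx] : exists sx : 'I_r.+1 -> A * V, forall k,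
    [/\ (sx k).1 \notin q, Z' (sx k).2 & B ((sx k).1%:MP *: x k - (sx k).2)].
  apply: (functional_choice (fun k (sx : A * V) =>
    [/\ sx.1 \notin q, Z' sx.2 & B (sx.1%:MP *: x k - sx.2)])) => k.
  by have [s sq [x' hx' hB]] := happ _ (hx k); exists (s, x').
have [|c [[k0 hk0] hB]] := h (fun k => (sx k).2); first by move=> k; case: (hsx k).
exists (fun k => c k * (sx k).1); split.
  by exists k0; apply: notin_primeM => //; case: (hsx k0).
have -> : \sum_k (c k * (sx k).1)%:MP *: x k =
    1%:MP *: (\sum_k (c k)%:MP *: (sx k).2) +
    \sum_k (c k)%:MP *: ((sx k).1%:MP *: x k - (sx k).2).
  rewrite mpolyC1 scale1r -big_split; apply: eq_bigr => k _ /=.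
  by rewrite scalerBr addrC subrK scalerA mpolyCM.
apply: (Blin) => //; elim/big_ind: _ => // [y z hy hz|k _].
  by rewrite -[y]scale1r -mpolyC1; apply: Blin.
by rewrite -[_ *: _]addr0; apply: Blin => //; case: (hsx k).
Qed.

Variables (E : nat -> gradedModule A n)
  (eta : {linear mpoly_graded A n -> E 0%N})
  (delta : forall i, {linear E i -> E i.+1}).
Hypothesis res : is_injective_resolution eta delta.
Variables (fs : seq (A * 'X_{1..n})) (u : zdeg n).
Hypothesis hfs : forall f, f \in fs -> f.1 != 0.

(** The analogue of [tcochain] without the condition of being killed by [q]. *)
Definition cochain i (x : E i) := x \in gr_comp (E i) u /\ ftor fs x.
Definition cocycle i (x : E i) := cochain x /\ delta i x = 0.
Definition coboundary i : E i -> Prop :=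
  match i with
  | 0 => fun x => x = 0
  | i'.+1 => fun x => exists2 y : E i', cochain y & x = delta i' y
  end.

Lemma cochainP i a (x y : E i) :
  cochain x -> cochain y -> cochain (a%:MP *: x + y).
Proof.
move=> [h1 h2] [h1' h2']; split; last exact: ftorP.
by apply: gr_memD => //; apply: gr_memZC.
Qed.

Lemma cochain0 i : cochain (0 : E i).
Proof. by split; [exact: gr_mem0 | exact: ftor0]. Qed.

Lemma cochainZ i a (x : E i) : cochain x -> cochain (a%:MP *: x).
Proof. by move=> h; rewrite -[_ *: _]addr0; apply: cochainP => //; apply: cochain0. Qed.

Lemma cochainB i (x y : E i) : cochain x -> cochain y -> cochain (x - y).
Proof.
move=> hx hy; rewrite -scaleN1r addrC (_ : -1 = (-1)%:MP); last first.
  by rewrite mpolyCN mpolyC1.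
exact: cochainP.
Qed.

Lemma cochain_delta i (x : E i) : cochain x -> cochain (delta i x).
Proof.
move=> [h1 h2]; split; first exact: (ir_delta res).
by move=> f /h2 [N hN]; exists N; rewrite -linearZ /= hN linear0.
Qed.

Lemma coboundaryP i a (x y : E i) :
  coboundary x -> coboundary y -> coboundary (a%:MP *: x + y).
Proof.
case: i x y => [|i] x y /= => [-> ->|[x' hx ->] [y' hy ->]].
  by rewrite scaler0 addr0.
by exists (a%:MP *: x' + y'); rewrite ?linearP //; apply: cochainP.
Qed.

Lemma coboundary0 i : coboundary (0 : E i).
Proof. by case: i => //= i; exists 0; [exact: cochain0 | rewrite linear0]. Qed.

Lemma tcoboundary_sub i x : tcoboundary q delta fs u x -> coboundary (x : E i).
Proof. by case: i x => //= i x [y [h1 _ h3] e]; exists y. Qed.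

Lemma cochain_division i (x : E i) : t != 0 -> cochain x ->
  exists2 s, s \notin q & exists2 y, cochain y & t%:MP *: y = s%:MP *: x.
Proof.
move=> t0 [h1 h2].
have [s sq [y [hy1 hy2 e]]] :=
  uniformizer_division hq (@ir_inj _ _ _ _ _ _ res i) t0 hfact hfs h1 h2.
by exists s => //; exists y.
Qed.

Lemma cochain_kill i (x : E i) : cochain x -> t%:MP *: x = 0 ->
  tcochain q fs u (s0%:MP *: x).
Proof.
move=> hx tx; have [h1 h2] := cochainZ s0 hx; split=> //.
exact: (killed_uniformizer hdiv).
Qed.

Lemma cocycle_zero_prime i (x : E i) : is_zero_ideal q -> cocycle x ->
  tcocycle q delta fs u x.
Proof.
move=> q0 [[h1 h2] dx]; split=> //; split=> // b /q0 ->.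
by rewrite mpolyC0 scale0r.
Qed.

Let bound i : dep_le q (fun x : E i => tcocycle q delta fs u x)
  (fun x => tcoboundary q delta fs u x) (2 ^ size fs).
Proof. exact: (tcohomology_bound hq tq s0q hdiv ht0 hfact res). Qed.

(** If $tx=\delta y$ and $ty'=sy$, then $sx-\delta y'$ is a cocycle killed by [t]. Hence the
    [t]-torsion of the cohomology comes, up to factors outside [q], from that of $E[q]$. *)
Lemma torsion_part_bound i :
  dep_le q (fun x : E i => cocycle x /\ coboundary (t%:MP *: x)) (@coboundary i)
    (2 ^ size fs).
Proof.
apply: (dep_le_approx (Z' := fun x : E i => tcocycle q delta fs u x)).
- exact: coboundaryP.
- exact: coboundary0.
- move=> x [hx htx]; have [q0|/ht0 t0] := classic (is_zero_ideal q).
    exists 1; first exact: notin_prime1.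
    exists x; first exact: cocycle_zero_prime.
    by rewrite mpolyC1 scale1r subrr; apply: coboundary0.
  case: i x hx htx => [|i] x [hx dx] /= => [tx|[y hy ey]].
    exists s0 => //; exists (s0%:MP *: x); last by rewrite subrr.
    by split; [exact: cochain_kill | rewrite linearZ /= dx scaler0].
  have [s sq [y' hy' ty']] := cochain_division t0 hy.
  exists (s0 * s); first exact: notin_primeM.
  exists (s0%:MP *: (s%:MP *: x - delta i y')).
    split; last first.
      by rewrite linearZ linearB linearZ /= dx (delta_delta res) scaler0 subrr scaler0.
    apply: cochain_kill.
      by apply: cochainB; [exact: cochainZ | exact: cochain_delta].
    rewrite scalerBr -[_ *: delta i y']linearZ /= ty' [delta i _]linearZ /= -ey.
    by rewrite !scalerA mulrC subrr.
  exists (s0%:MP *: y'); first exact: cochainZ.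
  by rewrite [RHS]linearZ /= scalerBr opprB addrC scalerA mpolyCM subrK.
by apply: (dep_le_sub _ _ (@bound i)) => // x; apply: tcoboundary_sub.
Qed.

(** A connecting homomorphism is at work: writing $sx=tw$, the cocycle $\delta w$ is killed by [t],
    and its class in $E[q]$ one degree higher controls [x] modulo [t]. If a combination of these
    classes is $\delta y$, subtracting [y] from the same combination of the [w] gives the cocycle
    [z]. *)
Lemma quotient_bound i :
  dep_le q (@cocycle i) (fun x => exists2 z, cocycle z & coboundary (x - t%:MP *: z))
    (2 ^ size fs).
Proof.
have cocycle0 j : cocycle (0 : E j) by split; [exact: cochain0 | rewrite linear0].
have [q0|/ht0 t0] := classic (is_zero_ideal q).
  apply: (dep_le_sub _ _ (@bound i)) => x; first exact: cocycle_zero_prime.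
  move=> hx; exists 0 => //; rewrite scaler0 subr0; exact: tcoboundary_sub.
move=> x hx.
have [w hw] : exists w : _ -> A * E i, forall k, [/\ (w k).1 \notin q,
    cochain (w k).2 & t%:MP *: (w k).2 = (w k).1%:MP *: x k].
  apply: (functional_choice (fun k (w : A * E i) => [/\ w.1 \notin q,
    cochain w.2 & t%:MP *: w.2 = w.1%:MP *: x k])) => k.
  by have [s sq [y hy e]] := cochain_division t0 (hx k).1; exists (s, y).
have [|c [[k0 hk0] [y [hy1 ky hy2] ey]]] :=
  @bound i.+1 (fun k => s0%:MP *: delta i (w k).2).
  move=> k; have [_ h2 h3] := hw k; split.
    apply: cochain_kill; first exact: cochain_delta.
    by rewrite -linearZ /= h3 linearZ /= (hx k).2 scaler0.
  by rewrite linearZ /= (delta_delta res) scaler0.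
exists (fun k => c k * s0 * (w k).1); split.
  by exists k0; apply: notin_primeM; [| apply: notin_primeM | case: (hw k0)].
exists (\sum_k (c k * s0)%:MP *: (w k).2 - y); last first.
  rewrite scalerBr ky // subr0 scaler_sumr -sumrB big1 => [|k _].
    exact: coboundary0.
  have [_ _ h3] := hw k.
  by rewrite [X in _ - X]scalerA [t%:MP * _]mulrC -scalerA h3 scalerA -mpolyCM subrr.
split.
  apply: cochainB => //; elim/big_ind: _ => [|z z' hz hz'|k _].
  - exact: cochain0.
  - by rewrite -[z]scale1r -mpolyC1; apply: cochainP.
  - by apply: cochainZ; case: (hw k).
rewrite linearB -ey raddf_sum; apply/eqP; rewrite subr_eq0; apply/eqP.
by apply: eq_bigr => k _; rewrite /= linearZ /= scalerA mpolyCM.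
Qed.

End ComponentBound.

Section LocalCohomologyBound.
Variables (A : idomainType) (n c : nat) (a : 'I_c -> A) (U : 'I_c -> 'X_{1..n}).
Notation R := {mpoly A[n]}.
Hypothesis ha : forall l, a l != 0.
Variables (i : nat) (M : gradedModule A n).
Hypothesis hM : is_local_cohomology (gen_ideal (fun l => a l *: 'X_[U l]))
  (mpoly_graded A n) i M.
Variables (u : zdeg n) (q : {pred A}) (hq : is_prime q).
Variables (t s0 : A).
Hypotheses (tq : t \in q) (s0q : s0 \notin q)
  (hdiv : forall r, r \in q -> exists z, s0 * r = t * z)
  (ht0 : ~ is_zero_ideal q -> t != 0)
  (hfact : forall b, b != 0 -> exists s m b',
    [/\ s \notin q, b' \notin q & s * b = t ^+ m * b']).

(** The map [h] identifies $M_u$ with the degree [u] cohomology, so the relations are found on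
    cocycles lifting the given elements. *)
Lemma component_bound : exists r,
  (forall x : 'I_r.+1 -> component M u, (forall k, t *: x k = 0) ->
    exists d, (exists k, d k \notin q) /\ \sum_k d k *: x k = 0) /\
  (forall x : 'I_r.+1 -> component M u,
    exists d, (exists k, d k \notin q) /\ exists w, \sum_k d k *: x k = t *: w).
Proof.
case: hM => E [eta [delta [h [res [hlin hsurj hker hgr]]]]].
pose fs := gen_seq a U; exists (2 ^ size fs)%N.
have hfs f : f \in fs -> f.1 != 0 by move=> /mapP [l _ ->]; apply: ha.
pose I := gen_ideal (fun l => a l *: 'X_[U l]).
have lcP (x : E i) : lc_cocycle I delta x <-> ftor fs x /\ delta i x = 0.
  by rewrite /lc_cocycle torsion_ftor.
have lc_of x : cocycle delta fs u x -> lc_cocycle I delta (x : E i).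
  by move=> [[_ h1] h2]; apply/lcP.
have cob_of x : coboundary delta fs u x -> lc_coboundary I delta (x : E i).
  clear -fs; case: i E delta x => [|j] E delta x //= [y [_ hy] e].
  by exists y => //; apply/torsion_ftor.
(* The torsion primitive need not be homogeneous; its degree [u] component is still torsion, because
   powers of the generators are homogeneous. *)
have of_cob x : x \in gr_comp (E i) u -> lc_coboundary I delta (x : E i) ->
    coboundary delta fs u x.
  clear -fs res; case: i E eta delta res x => [|j] E eta delta res x //= hx [y hy e].
  have [y' [hy' e' hann]] :=
    homogeneous_preimage (@ir_delta _ _ _ _ _ _ res j) hx e.
  exists y' => //; split=> // f hf; have [N hN] := (torsion_ftor _ _ _).1 hy f hf.
  exists N; apply: (hann _ (mnm_zdeg (f.2 *+ N)%MM)) hN => w z hz.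
  by rewrite cmonomX; apply: gr_memZX.
have lc0 : lc_cocycle I delta (0 : E i).
  by apply/lcP; split; [exact: ftor0 | rewrite linear0].
have h0 : h 0 = 0.
  by apply/hker => //; apply/cob_of/coboundary0.
have lcD p x y : lc_cocycle I delta x -> lc_cocycle I delta y ->
    lc_cocycle I delta (p *: x + y : E i).
  move=> /lcP [h1 h2] /lcP [h1' h2']; apply/lcP; split; first exact: ftorP.
  by rewrite linearP /= h2 h2' scaler0 addr0.
have hZ p x : lc_cocycle I delta x -> h (p *: x) = p *: h x.
  by move=> hx; rewrite -[p *: x]addr0 hlin // h0 addr0.
have hsum r (x : 'I_r -> E i) (d : 'I_r -> A) :
    (forall k, lc_cocycle I delta (x k)) ->
    lc_cocycle I delta (\sum_k (d k)%:MP *: x k) /\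
    h (\sum_k (d k)%:MP *: x k) = \sum_k (d k)%:MP *: h (x k).
  move=> hx; elim/big_ind2: _ => // [y1 y1' y2 y2' [l1 e1] [l2 e2]|k _].
    rewrite -[y1']scale1r; split; first exact: lcD.
    by rewrite hlin // e1 e2 scale1r.
  split; last exact: hZ.
  by rewrite -[_ *: _]addr0; apply: lcD.
have lift (x : component M u) : exists y : E i,
    cocycle delta fs u y /\ h y = comp_val x.
  have [y [hy1 hy2 e]] := (hgr u (comp_val x)).1 (comp_valP x).
  by exists y; split=> //; have [h1 h2] := (lcP y).1 hy1.
have {lift} [lift hlift] := functional_choice _ lift.
have val_sum r (x : 'I_r -> component M u) (d : 'I_r -> A) :
    comp_val (\sum_k d k *: x k) = h (\sum_k (d k)%:MP *: lift (x k)).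
  rewrite (hsum _ _ _ _).2 => [|k]; last by apply: lc_of; case: (hlift (x k)).
  rewrite -[comp_val _]/(val _) raddf_sum.
  by apply: eq_bigr => k _; rewrite (hlift (x k)).2.
have valZ b (x : component M u) : comp_val (b *: x) = b%:MP *: comp_val x by [].
have tors : dep_le q (fun y : E i => cocycle delta fs u y /\
      coboundary delta fs u (t%:MP *: y)) (fun y => coboundary delta fs u y)
    (2 ^ size fs).
  exact: (torsion_part_bound hq tq s0q hdiv ht0 hfact res hfs).
have quot : dep_le q (fun y : E i => cocycle delta fs u y)
    (fun y => exists2 z, cocycle delta fs u z & coboundary delta fs u (y - t%:MP *: z))
    (2 ^ size fs).
  exact: (quotient_bound hq tq s0q hdiv ht0 hfact res hfs).
split=> x => [hx|].
  have [k|d [hd hB]] := tors (fun k => lift (x k)).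
    have [hl e] := hlift (x k); split=> //; apply: of_cob.
      by apply: gr_memZC; case: hl => [[]].
    apply/hker.
      by rewrite -[_ *: _]addr0; apply: lcD => //; apply: lc_of.
    by rewrite hZ ?e -?valZ ?hx //; apply: lc_of.
  exists d; split=> //; apply: val_inj; rewrite /= val_sum.
  apply/hker; last exact: cob_of.
  by apply: (hsum _ _ _ _).1 => k; apply: lc_of; case: (hlift (x k)).
have [k|d [hd [z hz hB]]] := quot (fun k => lift (x k)); first by case: (hlift (x k)).
have hzM : h z \in gr_comp M u.
  by apply/hgr; exists z; split=> //; [exact: lc_of | case: hz => [[]]].
exists d; split=> //; exists (Component hzM); apply: val_inj.
rewrite /= val_sum -[LHS](subrK (t%:MP *: h z)) -[RHS]add0r; congr (_ + _).
have [ls es] := hsum _ (fun k => lift (x k)) d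
  (fun k => lc_of _ (hlift (x k)).1).
rewrite -scaleNr addrC -hlin //; last exact: lc_of.
rewrite addrC scaleNr; apply/hker; last exact: cob_of.
by rewrite addrC -scaleNr; apply: lcD => //; apply: lc_of.
Qed.

End LocalCohomologyBound.

(** The element [iota t] serves as [tau] in [ext_dim_finite]. Denominators move elements of [Lq] to
    [L], and they reappear as unit factors in the coefficients of the relations. *)
Lemma finite_bass_of_bound (A : idomainType) (q : {pred A}) (hq : is_prime q)
    (t s0 : A) (L : lmodType A) r :
  t \in q -> s0 \notin q -> (forall b, b \in q -> exists z, s0 * b = t * z) ->
  (forall x : 'I_r.+1 -> L, (forall k, t *: x k = 0) ->
    exists d, (exists k, d k \notin q) /\ \sum_k d k *: x k = 0) ->
  (forall x : 'I_r.+1 -> L,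
    exists d, (exists k, d k \notin q) /\ exists w, \sum_k d k *: x k = t *: w) ->
  forall j, finite_bass_number q L j.
Proof.
move=> tq s0q hdiv htors hquot j Aq iota k pi Lq psi P d eps hloc hres hlocm hP.
have pi_in y b : b \in q -> pi (iota b * y) = 0.
  by move=> bq; apply/(res_ker hres); exists b, y.
have pi_notin s : s \notin q -> pi (iota s) != 0.
  move=> /(loc_inv hloc) [s' hs]; apply/eqP => e.
  move/(congr1 pi): hs; rewrite rmorphM rmorph1 /= e mul0r => /esym/eqP.
  by rewrite oner_eq0.
have psiZ b x : psi (b *: x) = iota b *: psi x by rewrite linearZ.
have clear m (y : 'I_m -> Lq) : exists sx : 'I_m -> A * L, forall i,
    (sx i).1 \notin q /\ iota (sx i).1 *: y i = psi (sx i).2.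
  apply: (functional_choice (fun i (sx : A * L) =>
    sx.1 \notin q /\ iota sx.1 *: y i = psi sx.2)) => i.
  by have [x [s [sq e]]] := locm_frac hlocm (y i); exists (s, x).
apply: (ext_dim_finite (tau := iota t) _ _ _ _ _ hP).
- exact: res_surj hres.
- move=> y /(res_ker hres) [b [z [bq ->]]]; have [w hw] := hdiv b bq.
  have [s' hs'] := loc_inv hloc s0q; exists (s' * iota w * z).
  transitivity (s' * (iota s0 * iota b) * z).
    by rewrite -[LHS]mul1r -hs'; ring.
  by rewrite -rmorphM hw rmorphM; ring.
- by rewrite -[iota t]mulr1 pi_in.
- move=> y hy; have [b [s [sq e]]] := loc_frac hloc y.
  have bq : b \notin q.
    apply/negP => bq; move/(congr1 pi): e; rewrite rmorphM /=.
    rewrite -[X in _ = pi X]mulr1 pi_in // => /eqP.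
    by rewrite mulf_eq0 (negPf hy) (negPf (pi_notin _ sq)).
  have [b' hb'] := loc_inv hloc bq; exists (b' * iota s).
  by rewrite -mulrA e mulrC.
- have [->|t0] := eqVneq t 0; [by left; rewrite rmorph0 | right=> y hy].
  have [b [s [sq e]]] := loc_frac hloc y; have [s' hs'] := loc_inv hloc sq.
  have : iota (t * b) = 0 by rewrite rmorphM -e mulrCA hy mulr0.
  move=> /(loc_ker hloc) [s1 s1q /eqP].
  rewrite mulrA mulf_eq0 mulf_eq0 (negPf t0) (negPf (notin_prime_neq0 hq s1q)) /=.
  move=> /eqP b0; rewrite b0 rmorph0 in e.
  by rewrite -[y]mul1r -hs' mulrAC e mul0r.
- exists r => y hy; have [sx hsx] := clear _ y.
  (* Vanishing in [Lq] only means vanishing in [L] after multiplication by some [s] outside [q]. *)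
  have [s hs] : exists s : 'I_r.+1 -> A, forall i,
      s i \notin q /\ s i *: (t *: (sx i).2) = 0.
    apply: (functional_choice (fun i s => s \notin q /\ s *: (t *: (sx i).2) = 0)) => i.
    have [|s sq e] := locm_ker hlocm (x := t *: (sx i).2); last by exists s.
    by rewrite psiZ -(hsx i).2 scalerA mulrC -scalerA hy scaler0.
  have [i|e [[i ei] he]] := htors (fun i => s i *: (sx i).2).
    by rewrite scalerA mulrC -scalerA (hs i).2.
  exists (fun i => iota (e i * s i * (sx i).1)); split.
    exists i; apply: pi_notin; apply: notin_primeM (hsx i).1 => //.
    exact: notin_primeM (hs i).1.
  rewrite -[RHS](linear0 psi) -he raddf_sum; apply: eq_bigr => i' _ /=.
  by rewrite !psiZ -(hsx i').2 !scalerA -!rmorphM.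
- exists r => y; have [sx hsx] := clear _ y.
  have [e [[i ei] [w he]]] := hquot (fun i => (sx i).2).
  exists (fun i => iota (e i * (sx i).1)); split.
    by exists i; apply: pi_notin; apply: notin_primeM (hsx i).1.
  exists (psi w); rewrite -psiZ -he raddf_sum; apply: eq_bigr => i' _ /=.
  by rewrite psiZ -(hsx i').2 scalerA -rmorphM.
Qed.

Theorem corollary6p6 (A : idomainType) (hA : dedekind A) (hA0 : char_zero A)
  (hAp : forall p : {pred A}, height_one p -> mixed_char_finite_residue p)
  (n c : nat) (a : 'I_c -> A) (U : 'I_c -> 'X_{1..n})
  (ha : forall l, a l != 0) (hU : forall l, U l != 0%MM)
  (i : nat) (M : gradedModule A n)
  (hM : is_local_cohomology (gen_ideal (fun l => a l *: 'X_[U l]))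
          (mpoly_graded A n) i M)
  (u : zdeg n) (q : {pred A}) (hq : is_prime q) (j : nat) :
  finite_bass_number q (component M u) j.
Proof.
have [t [s0 [tq s0q hdiv ht0]]] := local_uniformizer hA hq.
have hfact := uniformizer_factor hA hq tq s0q hdiv.
have [r [htors hquot]] := component_bound ha hM u hq tq s0q hdiv ht0 hfact.
exact: (finite_bass_of_bound hq tq s0q hdiv htors hquot).
Qed.
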